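(* Let $\Phi$ be a local interaction on $V$ and $\beta>0$, and assume that $\Phi$ has strong local effective Hamiltonians at $\beta$, i.e. for every $L\subset V$ there is a local interaction $\widetilde\Phi^{L,\beta}$ on $V$ such that (i) $\widetilde\Phi^{L,\beta}_X$ is supported in $X\cap L$ for every finite $X$; (ii) for every $L'\subset V$, $\widetilde\Phi^{L,\beta}_X=\widetilde\Phi^{L',\beta}_X$ for all finite $X$ with $X\cap L'=X\cap L$; (iii) for every finite $\Lambda\subset V$, $-\frac1\beta\log\mathbb E_L[e^{-\beta H_\Lambda}]=\sum_{X\subset\Lambda}\widetilde\Phi^{L,\beta}_X$. Assume further that there are $\lambda,\mu,\Delta>0$ such that for every $L\subset V$ $$\sup_{x\in V}\sum_{X\ni x}\|\widetilde\Phi^{L,\beta}_X\|\,e^{\lambda|X|+\mu\operatorname{diam}(X)}\le\Delta .$$ Then, if $\beta<\lambda/(2\Delta)$, for every finite $\Lambda\subset V$ and every pair of disjoint nonempty subsets $A,C\subset\Lambda$, the Gibbs state $\rho=\rho^\Lambda_\beta$ satisfies $$\big\|\rho_{AC}\,\rho_A^{-1}\otimes\rho_C^{-1}-\mathbb 1\big\|\le\exp\Big(\frac{4\Delta\lambda\beta}{\lambda-2\Delta\beta}\sum_{x\in A}e^{-\mu\operatorname{dist}(x,C)}\Big)\,\frac{4\Delta\lambda\beta}{\lambda-2\Delta\beta}\sum_{x\in A}e^{-\mu\operatorname{dist}(x,C)}.$$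
   Context: $V$ is a set with a metric $\operatorname{dist}$; $\operatorname{diam}(X)=\max_{x,y\in X}\operatorname{dist}(x,y)$. Each site carries $\mathbb C^D$; $\mathfrak A_X=\mathcal B(\mathcal H_X)$, $\mathcal H_X=\bigotimes_{v\in X}\mathbb C^D$ for finite $X$, embedded in $\mathfrak A_Y$ ($X\subset Y$) via $Q\mapsto Q\otimes\mathbb 1$. A local interaction is a family $(\Phi_X)$ indexed by finite $X\subset V$ with $\Phi_X=\Phi_X^*\in\mathfrak A_X$; $H_\Lambda=\sum_{X\subset\Lambda}\Phi_X$. For $L\subset V$ and $Q\in\mathfrak A_\Lambda$, $\mathbb E_L[Q]=D^{-|\Lambda\setminus L|}\operatorname{tr}_{\Lambda\setminus L}(Q)\otimes\mathbb 1_{\Lambda\setminus L}$; $\log$ is the self-adjoint logarithm. The Gibbs state is $\rho^\Lambda_\beta=e^{-\beta H_\Lambda}/\operatorname{Tr}[e^{-\beta H_\Lambda}]$ and for $X\subset\Lambda$, $\rho_X=\operatorname{tr}_{\Lambda\setminus X}\rho^\Lambda_\beta$ is its marginal on $\mathcal H_X$; $\rho_{AC}\,\rho_A^{-1}\otimes\rho_C^{-1}$ is the product of operators on $\mathcal H_{A\cup C}$. $\|\cdot\|$ is the operator norm. *)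

(* Defs.v *)
Set Warnings "-all".
(* mathcomp + finmap + mathcomp-analysis (realType R),
   complex numbers R[i] from mathcomp-real-closed. *)
From HB Require Import structures.
From mathcomp Require Import all_boot all_order all_algebra finmap.
From mathcomp Require Import all_classical all_reals all_analysis.
From mathcomp Require Import complex.
Set Implicit Arguments. Unset Strict Implicit. Unset Printing Implicit Defensive.
Import Order.TTheory GRing.Theory Num.Theory numFieldNormedType.Exports.
Local Open Scope fset_scope.
Local Open Scope classical_set_scope.
Local Open Scope ring_scope.

(* ---------- complex matrices: exponential, logarithm, operator norm ---------- *)

Section Matrices.
Variable R : realType.
Local Notation C := (R[i]).

(* selfadj (self-adjoint) square matrix: A = A^* *)
Definition selfadj n (A : 'M[C]_n) : Prop := A = (map_mx (fun z : C => z^*) A)^T.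

(* partial sums of the exponential series *)
Definition exp_psum n (A : 'M[C]_n) (N : nat) : 'M[C]_n :=
  \sum_(k < N) ((k`!)%:R)^-1 *: A ^+ k.

(* matrix exponential, e^A = sum_k A^k / k!, limit taken entrywise
   (real and imaginary parts separately, as limits of real sequences) *)
Definition expm n (A : 'M[C]_n) : 'M[C]_n :=
  \matrix_(i, j) Complex (limn (fun N => complex.Re (exp_psum A N i j)))
                         (limn (fun N => complex.Im (exp_psum A N i j))).

(* the self-adjoint logarithm: the self-adjoint L with e^L = Q
   (unique when it exists, e.g. for Q positive definite) *)
Definition slog n (Q : 'M[C]_n) : 'M[C]_n :=
  xget 0 [set L : 'M[C]_n | selfadj L /\ expm L = Q].

(* Euclidean norm of a column vector *)
Definition vnorm n (v : 'cV[C]_n) : R :=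
  Num.sqrt (\sum_i (complex.Re (v i 0) ^+ 2 + complex.Im (v i 0) ^+ 2)).

(* operator norm *)
Definition opnorm n (A : 'M[C]_n) : R :=
  sup [set vnorm (A *m v) | v in [set v : 'cV[C]_n | vnorm v <= 1]].

End Matrices.

(* ---------- the quantum spin system on a set V ---------- *)

Section Spins.
Variable R : realType.
Local Notation C := (R[i]).
Variable V : choiceType.
Variable D : nat.  (* local Hilbert space C^D at every site *)

(* basis of H_X = (C^D)^{tensor X}: configurations X -> {0,..,D-1} *)
Definition conf (X : {fset V}) := {ffun X -> 'I_D}.
Definition hdim (X : {fset V}) := #|{: conf X}|.
(* the algebra A_X = B(H_X) *)
Definition op (X : {fset V}) := 'M[C]_(hdim X).

Definition entry X (A : op X) (s t : conf X) : C := A (enum_rank s) (enum_rank t).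
Definition mkop X (f : conf X -> conf X -> C) : op X :=
  \matrix_(i, j) f (enum_val i) (enum_val j).

(* s : conf X and t : conf Y coincide at all common sites v with P v *)
Definition agreeOn (P : pred V) X Y (s : conf X) (t : conf Y) : bool :=
  [forall x : X, forall y : Y, ((val x == val y) && P (val x)) ==> (s x == t y)].

(* embedding A_X -> A_Y, Q |-> Q (x) 1_{Y \ X}  (for X a subset of Y) *)
Definition embed X Y (Q : op X) : op Y :=
  mkop (fun s t : conf Y =>
    (agreeOn (fun v => v \notin X) s t)%:R *
    \sum_(s' : conf X) \sum_(t' : conf X)
       ((agreeOn predT s' s && agreeOn predT t' t)%:R * entry Q s' t')).

(* partial trace tr_{Y \ X} : A_Y -> A_X  (for X a subset of Y) *)
Definition ptrace Y X (Q : op Y) : op X :=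
  mkop (fun a a' : conf X =>
    \sum_(s : conf Y) \sum_(t : conf Y)
      ((agreeOn predT a s && agreeOn predT a' t
          && agreeOn (fun v => v \notin X) s t)%:R * entry Q s t)).

(* X intersected with an arbitrary (possibly infinite) L, and X \ L *)
Definition fsetIs (X : {fset V}) (L : set V) : {fset V} := [fset x in X | x \in L].
Definition fsetDs (X : {fset V}) (L : set V) : {fset V} := [fset x in X | x \notin L].

(* E_L[Q] = D^{-|Lam \ L|} tr_{Lam \ L}(Q) (x) 1_{Lam \ L}, for Q in A_Lam *)
Definition condexp (L : set V) (Lam : {fset V}) (Q : op Lam) : op Lam :=
  ((D%:R : C) ^- #|` fsetDs Lam L|) *: embed Lam (ptrace (fsetIs Lam L) Q).

(* H_Lam = sum_{X subset Lam} Phi_X *)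
Definition hamiltonian (Phi : forall X : {fset V}, op X) (Lam : {fset V}) : op Lam :=
  \sum_(X <- fpowerset Lam) embed Lam (Phi X).

(* Gibbs state rho^Lam_beta *)
Definition gibbs (Phi : forall X : {fset V}, op X) (beta : R) (Lam : {fset V}) : op Lam :=
  let E := expm (- (beta%:C)%C *: hamiltonian Phi Lam) in (\tr E)^-1 *: E.

(* A in A_X is supported in Y (Y subset of X): A = Q (x) 1 for some Q in A_Y *)
Definition supported_in (X Y : {fset V}) (A : op X) : Prop :=
  exists Q : op Y, A = embed X Q.

End Spins.

(* ---------- metric notions ---------- *)
Section Metric.
Local Open Scope ring_scope.
Variable R : realType.
Variable V : choiceType.
Variable dist : V -> V -> R.

Definition is_metric : Prop :=
  [/\ forall x y, dist x y = 0 <-> x = y,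
      forall x y, dist x y = dist y x &
      forall x y z, dist x z <= dist x y + dist y z].

(* diam X = max_{x,y in X} dist x y  (0 for the empty set) *)
Definition diam (X : {fset V}) : R := \big[Num.max/0]_(x <- X) \big[Num.max/0]_(y <- X) dist x y.

(* dist(x, C) = min_{y in C} dist x y  (C nonempty) *)
Definition dist_set (x : V) (C : {fset V}) : R := inf [set dist x y | y in [set` C]].
End Metric.

(* Main.v *)
(** Write [K_L] for the effective Hamiltonian [\sum_(X <= Lam) Phit L X], so that
    [E_L[e^(-beta H)] = e^(-beta K_L)].  Up to powers of [D] and the partition function,
    which together are absorbed by [e^(-beta K_0)], the operator
    [rho_AC rho_A^-1 rho_C^-1] is
    [e^(-beta K_AC) e^(beta K_A) e^(beta K_C) e^(-beta K_0)].  The last three factors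
    commute, so it differs from the identity only through
    [W := K_AC - K_A - K_C + K_0], in which all terms cancel except those with [X]
    meeting both [A] and [C]; these are exponentially small in the distance.  In the
    interaction picture the norm is controlled by [e^(-sK) W e^(sK)], [K := K_AC],
    [0 <= s <= beta], whose expansion in iterated commutators converges because
    [|ad_K^k Q| <= |Q| e^(lambda |X|) k! (2 Delta / lambda)^k] for [Q] supported in [X].

    All exponentials involved are those of self-adjoint matrices, so they are computed
    by unitary diagonalisation; the differential equation of the interaction picture is
    replaced by its Euler scheme.  The embedding [A_X -> A_Y] and the partial trace are
    written [\sum_r J_r Q J_r^*] and [\sum_r J_r^* Q J_r], for the isometries [J_r] that
    tensor with the basis vector [r] of the complement. *)

Require Import Defs.
Set Warnings "-all".
From HB Require Import structures.
From mathcomp Require Import all_boot all_order all_algebra finmap.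
From mathcomp Require Import all_classical all_reals all_analysis.
From mathcomp Require Import complex.
From mathcomp Require Import spectral sesquilinear ring lra zify.
Set Implicit Arguments. Unset Strict Implicit. Unset Printing Implicit Defensive.
Import Order.TTheory GRing.Theory Num.Theory numFieldNormedType.Exports.
Local Open Scope fset_scope.
Local Open Scope classical_set_scope.
Local Open Scope ring_scope.

(** * Euclidean norm of vectors and operator norm of complex matrices *)

Section OperatorNorm.
Variable R : realType.
Local Notation C := (R[i]).
Local Notation normc := ComplexField.Normc.normc.

Lemma normc_ge0 (z : C) : 0 <= normc z.
Proof. by case: z => a b /=; exact: sqrtr_ge0. Qed.

Lemma sqr_normc_ReIm (z : C) : normc z ^+ 2 = complex.Re z ^+ 2 + complex.Im z ^+ 2.
Proof. by case: z => a b /=; rewrite sqr_sqrtr // addr_ge0 // sqr_ge0. Qed.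

Lemma normc_real (x : R) : normc (x%:C)%C = `|x|.
Proof. by rewrite /= expr0n /= addr0 sqrtr_sqr. Qed.

Lemma vnorm_ge0 n (v : 'cV[C]_n) : 0 <= vnorm v.
Proof. exact: sqrtr_ge0. Qed.

Lemma sqr_vnorm n (v : 'cV[C]_n) : vnorm v ^+ 2 = \sum_i normc (v i 0) ^+ 2.
Proof.
rewrite /vnorm sqr_sqrtr; first by apply: eq_bigr => i _; rewrite sqr_normc_ReIm.
by apply: sumr_ge0 => i _; rewrite addr_ge0 // sqr_ge0.
Qed.

Lemma normc_le_vnorm n (v : 'cV[C]_n) i : normc (v i 0) <= vnorm v.
Proof.
rewrite -(@ler_pXn2r _ 2) ?nnegrE ?normc_ge0 ?vnorm_ge0 // sqr_vnorm (bigD1 i) //=.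
by rewrite lerDl sumr_ge0 // => j _; rewrite sqr_ge0.
Qed.

Lemma vnorm0 n : vnorm (0 : 'cV[C]_n) = 0.
Proof.
apply/eqP; rewrite -sqrf_eq0 sqr_vnorm big1 // => i _.
by rewrite mxE ComplexField.Normc.normc0 expr0n.
Qed.

Lemma vnorm_eq0 n (v : 'cV[C]_n) : vnorm v = 0 -> v = 0.
Proof.
move=> v0; apply/matrixP => i j; rewrite ord1 mxE.
apply: ComplexField.Normc.eq0_normc; apply/eqP.
by rewrite eq_le normc_ge0 andbT -v0 normc_le_vnorm.
Qed.

Lemma vnormZ n c (v : 'cV[C]_n) : vnorm (c *: v) = normc c * vnorm v.
Proof.
apply/eqP; rewrite -(@eqrXn2 _ 2) ?mulr_ge0 ?normc_ge0 ?vnorm_ge0 //.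
rewrite exprMn !sqr_vnorm mulr_sumr; apply/eqP; apply: eq_bigr => i _.
by rewrite mxE ComplexField.Normc.normcM exprMn.
Qed.

(** Minkowski's inequality by weighted arithmetic-geometric means: with [p], [q] the two norms, the
    weights [1 + q/p] and [1 + p/q] are those for which summing the coordinatewise bound gives
    exactly [(p + q)^2]. *)
Lemma vnormD n (u v : 'cV[C]_n) : vnorm (u + v) <= vnorm u + vnorm v.
Proof.
have [p0|pN] := eqVneq (vnorm u) 0.
  by rewrite (vnorm_eq0 p0) add0r vnorm0 add0r.
have [q0|qN] := eqVneq (vnorm v) 0.
  by rewrite (vnorm_eq0 q0) addr0 vnorm0 addr0.
have p_gt0 : 0 < vnorm u by rewrite lt_def pN vnorm_ge0.
have q_gt0 : 0 < vnorm v by rewrite lt_def qN vnorm_ge0.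
set p := vnorm u in p_gt0 pN *; set q := vnorm v in q_gt0 qN *.
have amgm (a b : R) : (a + b) ^+ 2 <= (1 + q / p) * a ^+ 2 + (1 + p / q) * b ^+ 2.
  rewrite -subr_ge0.
  suff -> : (1 + q / p) * a ^+ 2 + (1 + p / q) * b ^+ 2 - (a + b) ^+ 2
    = (q * a - p * b) ^+ 2 / (p * q) by rewrite divr_ge0 ?sqr_ge0 // mulr_ge0 // ltW.
  by field; rewrite pN qN.
rewrite -(@ler_pXn2r _ 2) ?nnegrE ?addr_ge0 ?vnorm_ge0 //.
rewrite sqr_vnorm.
have -> : (p + q) ^+ 2 = (1 + q / p) * p ^+ 2 + (1 + p / q) * q ^+ 2.
  by field; rewrite pN qN.
rewrite [p ^+ 2]sqr_vnorm [q ^+ 2]sqr_vnorm !mulr_sumr -big_split /=; apply: ler_sum => i _.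
rewrite mxE !sqr_normc_ReIm.
case: (u i 0) => a b; case: (v i 0) => c d /=.
by have := amgm a c; have := amgm b d; lra.
Qed.

Lemma vnorm_sum n (I : Type) (r : seq I) (P : pred I) (F : I -> 'cV[C]_n) :
  vnorm (\sum_(i <- r | P i) F i) <= \sum_(i <- r | P i) vnorm (F i).
Proof.
elim/big_rec2: _ => [|i y x _ le_xy]; first by rewrite vnorm0.
by apply: (le_trans (vnormD _ _)); rewrite lerD2l.
Qed.

(** A crude majorant of the operator norm: it shows that the supremum in [opnorm] is over a bounded
    set, and it turns entrywise convergence into convergence in norm. *)
Definition entrysum m n (A : 'M[C]_(m, n)) : R := \sum_i \sum_j normc (A i j).

Lemma entrysum_ge0 m n (A : 'M[C]_(m, n)) : 0 <= entrysum A.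
Proof. by apply: sumr_ge0 => i _; apply: sumr_ge0 => j _; exact: normc_ge0. Qed.

Lemma vnorm_le_entrysum m n (A : 'M[C]_(m, n)) v :
  vnorm (A *m v) <= entrysum A * vnorm v.
Proof.
rewrite {1}(matrix_sum_delta A) mulmx_suml; apply: (le_trans (vnorm_sum _ _ _)).
rewrite mulr_suml; apply: ler_sum => i _.
rewrite mulmx_suml; apply: (le_trans (vnorm_sum _ _ _)).
rewrite mulr_suml; apply: ler_sum => j _.
rewrite -scalemxAl vnormZ; apply: ler_wpM2l; first exact: normc_ge0.
have -> : delta_mx i j *m v = v j 0 *: delta_mx i 0.
  apply/matrixP => k l; rewrite !mxE (bigD1 j) //= big1 ?addr0.
    by rewrite !mxE eqxx ord1 eqxx !andbT mulrC.
  by move=> t tj; rewrite !mxE (negPf tj) andbF mul0r.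
rewrite vnormZ -[leRHS]mulr1 ler_pM ?normc_ge0 ?vnorm_ge0 ?normc_le_vnorm //.
rewrite -(@ler_pXn2r _ 2) ?nnegrE ?vnorm_ge0 // sqr_vnorm (bigD1 i) //= big1.
  by rewrite mxE !eqxx ComplexField.Normc.normc1 addr0.
by move=> t ti; rewrite mxE (negPf ti) ComplexField.Normc.normc0 expr0n.
Qed.

Lemma opnorm_le n (A : 'M[C]_n) c :
  0 <= c -> (forall v, vnorm (A *m v) <= c * vnorm v) -> opnorm A <= c.
Proof.
move=> c0 Ac; apply: ge_sup.
  by exists (vnorm (A *m 0)), 0 => //=; rewrite vnorm0.
move=> _ [v /= v1 <-]; apply: (le_trans (Ac v)).
by rewrite -[leRHS]mulr1 ler_wpM2l.
Qed.

Lemma opnorm_ub n (A : 'M[C]_n) v : vnorm v <= 1 -> vnorm (A *m v) <= opnorm A.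
Proof.
move=> v1; apply: ub_le_sup; last by exists v.
exists (entrysum A) => _ [u /= u1 <-]; apply: (le_trans (vnorm_le_entrysum _ _)).
by rewrite -[leRHS]mulr1 ler_wpM2l // entrysum_ge0.
Qed.

Lemma opnorm_ge0 n (A : 'M[C]_n) : 0 <= opnorm A.
Proof.
by apply: (@le_trans _ _ (vnorm (A *m 0))); rewrite ?vnorm_ge0 // opnorm_ub ?vnorm0.
Qed.

Lemma opnormP n (A : 'M[C]_n) v : vnorm (A *m v) <= opnorm A * vnorm v.
Proof.
have [v0|vN] := eqVneq (vnorm v) 0.
  by rewrite (vnorm_eq0 v0) mulmx0 vnorm0 mulr0.
have v_gt0 : 0 < vnorm v by rewrite lt_def vN vnorm_ge0.
have nv : vnorm ((((vnorm v)^-1)%:C)%C *: v) = 1.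
  by rewrite vnormZ normc_real ger0_norm ?invr_ge0 ?ltW // mulVf.
have := @opnorm_ub _ A ((((vnorm v)^-1)%:C)%C *: v).
rewrite nv lexx => /(_ isT).
rewrite -scalemxAr vnormZ normc_real ger0_norm ?invr_ge0 ?(ltW v_gt0) //.
by rewrite ler_pdivrMl // mulrC.
Qed.

Lemma opnorm_le_entrysum n (A : 'M[C]_n) : opnorm A <= entrysum A.
Proof. by apply: opnorm_le; [exact: entrysum_ge0 | exact: vnorm_le_entrysum]. Qed.

Lemma opnormD n (A B : 'M[C]_n) : opnorm (A + B) <= opnorm A + opnorm B.
Proof.
apply: opnorm_le; first by rewrite addr_ge0 // opnorm_ge0.
move=> v; rewrite mulmxDl mulrDl; apply: (le_trans (vnormD _ _)).
by apply: lerD; exact: opnormP.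
Qed.

Lemma opnormM n (A B : 'M[C]_n) : opnorm (A *m B) <= opnorm A * opnorm B.
Proof.
apply: opnorm_le; first by rewrite mulr_ge0 // opnorm_ge0.
move=> v; rewrite -mulmxA -mulrA; apply: (le_trans (opnormP _ _)).
by rewrite ler_wpM2l ?opnorm_ge0 // opnormP.
Qed.

Lemma opnormZ n c (A : 'M[C]_n) : opnorm (c *: A) <= normc c * opnorm A.
Proof.
apply: opnorm_le; first by rewrite mulr_ge0 ?normc_ge0 ?opnorm_ge0.
move=> v; rewrite -scalemxAl vnormZ -mulrA ler_wpM2l ?normc_ge0 //; exact: opnormP.
Qed.

Lemma opnormZr n (c : R) (A : 'M[C]_n) : opnorm ((c%:C)%C *: A) <= `|c| * opnorm A.
Proof. by rewrite -normc_real; exact: opnormZ. Qed.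

Lemma opnormN n (A : 'M[C]_n) : opnorm (- A) <= opnorm A.
Proof.
have := @opnormZr _ (-1) A; rewrite normrN1 mul1r.
by rewrite rmorphN rmorph1 scaleN1r.
Qed.

Lemma opnormB n (A B : 'M[C]_n) : opnorm (A - B) <= opnorm A + opnorm B.
Proof. by apply: (le_trans (opnormD _ _)); rewrite lerD2l opnormN. Qed.

Lemma opnorm0 n : opnorm (0 : 'M[C]_n) = 0.
Proof.
apply/eqP; rewrite eq_le opnorm_ge0 andbT.
by apply: opnorm_le => // v; rewrite mul0mx vnorm0 mul0r.
Qed.

Lemma opnorm1 n : opnorm (1%:M : 'M[C]_n) <= 1.
Proof. by apply: opnorm_le => // v; rewrite mul1mx mul1r. Qed.

Lemma opnorm_sum n (I : Type) (r : seq I) (P : pred I) (F : I -> 'M[C]_n) :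
  opnorm (\sum_(i <- r | P i) F i) <= \sum_(i <- r | P i) opnorm (F i).
Proof.
elim/big_rec2: _ => [|i y x _ le_xy]; first by rewrite opnorm0.
by apply: (le_trans (opnormD _ _)); rewrite lerD2l.
Qed.

End OperatorNorm.

(** * Entrywise limits of matrices and their operator norm *)

Section EntrywiseLimits.
Variable R : realType.
Local Notation C := (R[i]).
Local Notation normc := ComplexField.Normc.normc.

(** Real and imaginary parts are kept apart to match the componentwise limits in the definition of
    [expm]. *)
Definition ccvg (u : nat -> C) (z : C) : Prop :=
  (complex.Re (u k) @[k --> \oo] --> complex.Re z) /\
  (complex.Im (u k) @[k --> \oo] --> complex.Im z).

Lemma ccvg_cst z : ccvg (fun=> z) z.
Proof. by split; exact: cvg_cst. Qed.

Lemma ccvgD u v y z : ccvg u y -> ccvg v z -> ccvg (fun k => u k + v k) (y + z).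
Proof.
move=> [ur ui] [vr vi].
have ReD (a b : C) : complex.Re (a + b) = complex.Re a + complex.Re b by case: a b => ? ? [].
have ImD (a b : C) : complex.Im (a + b) = complex.Im a + complex.Im b by case: a b => ? ? [].
by split; rewrite ?ReD ?ImD; under eq_fun do rewrite ?ReD ?ImD; exact: cvgD.
Qed.

Lemma ccvgMl c u z : ccvg u z -> ccvg (fun k => c * u k) (c * z).
Proof.
move=> [ur ui]; case: c => a b.
have ReM (w : C) : complex.Re (Complex a b * w) = a * complex.Re w - b * complex.Im w.
  by case: w.
have ImM (w : C) : complex.Im (Complex a b * w) = a * complex.Im w + b * complex.Re w.
  by case: w.
by split; rewrite ?ReM ?ImM; under eq_fun do rewrite ?ReM ?ImM;
  [apply: cvgB | apply: cvgD]; apply: cvgMr.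
Qed.

Lemma ccvgMr c u z : ccvg u z -> ccvg (fun k => u k * c) (z * c).
Proof.
by move=> /(@ccvgMl c); rewrite mulrC; under [X in ccvg X _]eq_fun do rewrite mulrC.
Qed.

Lemma ccvg_sum (I : Type) (r : seq I) (u : I -> nat -> C) (z : I -> C) :
  (forall i, ccvg (u i) (z i)) ->
  ccvg (fun k => \sum_(i <- r) u i k) (\sum_(i <- r) z i).
Proof.
move=> uz; elim: r => [|i r IH].
  rewrite big_nil; under [X in ccvg X _]eq_fun do rewrite big_nil; exact: ccvg_cst.
rewrite big_cons; under [X in ccvg X _]eq_fun do rewrite big_cons; exact: ccvgD.
Qed.

Lemma ccvg_real (u : nat -> R) (l : R) :
  u k @[k --> \oo] --> l -> ccvg (fun k => ((u k)%:C)%C) (l%:C)%C.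
Proof. by move=> ul; split => //=; exact: cvg_cst. Qed.

Definition mcvg m n (S : nat -> 'M[C]_(m, n)) (M : 'M[C]_(m, n)) : Prop :=
  forall i j, ccvg (fun k => S k i j) (M i j).

Lemma mcvg_mulmxl m n p (A : 'M[C]_(m, n)) (S : nat -> 'M[C]_(n, p)) M :
  mcvg S M -> mcvg (fun k => A *m S k) (A *m M).
Proof.
move=> SM i j; rewrite mxE; under [X in ccvg X _]eq_fun do rewrite mxE.
by apply: ccvg_sum => k; apply: ccvgMl; exact: SM.
Qed.

Lemma mcvg_mulmxr m n p (A : 'M[C]_(n, p)) (S : nat -> 'M[C]_(m, n)) M :
  mcvg S M -> mcvg (fun k => S k *m A) (M *m A).
Proof.
move=> SM i j; rewrite mxE; under [X in ccvg X _]eq_fun do rewrite mxE.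
by apply: ccvg_sum => k; apply: ccvgMr; exact: SM.
Qed.

(** The [limn] in [expm] is only meaningful for convergent sequences; every evaluation of an
    exponential from its series therefore goes through a proof of convergence. *)
Lemma expm_lim n (A M : 'M[C]_n) : mcvg (exp_psum A) M -> expm A = M.
Proof.
move=> AM; apply/matrixP => i j; rewrite mxE; have [ar ai] := AM i j.
by rewrite (cvg_lim _ ar) // (cvg_lim _ ai) //; case: (M i j).
Qed.

Lemma entrysum_cvg0 n (S : nat -> 'M[C]_n) M :
  mcvg S M -> entrysum (M - S k) @[k --> \oo] --> (0 : R).
Proof.
move=> SM; rewrite /entrysum.
have cvg_sum0 (f : 'I_n -> nat -> R) : (forall i, f i k @[k --> \oo] --> (0 : R)) ->
    \sum_i f i k @[k --> \oo] --> (0 : R).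
  move=> f0; elim: (index_enum _) => [|i r IH].
    by under eq_fun do rewrite big_nil; exact: cvg_cst.
  under eq_fun do rewrite big_cons.
  by have := cvgD (f0 i) IH; rewrite addr0; apply.
apply: (cvg_sum0) => i; apply: (cvg_sum0) => j.
have [sr si] := SM i j.
have nc (z : C) : normc z = Num.sqrt (complex.Re z ^+ 2 + complex.Im z ^+ 2) by case: z.
have ReB (a b : C) : complex.Re (a - b) = complex.Re a - complex.Re b by case: a b => ? ? [].
have ImB (a b : C) : complex.Im (a - b) = complex.Im a - complex.Im b by case: a b => ? ? [].
under eq_fun do rewrite nc !mxE ReB ImB.
have sq0 (f : nat -> R) (l : R) : f k @[k --> \oo] --> l -> (l - f k) ^+ 2 @[k --> \oo] --> (0:R).
  move=> fl; have -> : (0 : R) = (l - l) * (l - l) by rewrite subrr mulr0.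
  under eq_fun do rewrite expr2.
  by apply: cvgM; apply: cvgB => //; exact: cvg_cst.
have -> : (0 : R) = Num.sqrt (0 + 0) by rewrite addr0 sqrtr0.
apply: continuous_cvg; first exact: sqrt_continuous.
by apply: cvgD; exact: sq0.
Qed.

(** The norm of [M] exceeds that of [S N] by at most [entrysum (M - S N)], which tends to 0. *)
Lemma opnorm_mcvg n (S : nat -> 'M[C]_n) M B :
  mcvg S M -> (forall k, opnorm (S k) <= B) -> opnorm M <= B.
Proof.
move=> SM SB; apply/ler_addgt0Pr => e e0.
have /cvgrPdist_lt /(_ e e0) [N _ /(_ N (leqnn N))] := entrysum_cvg0 SM.
rewrite /= sub0r normrN ger0_norm ?entrysum_ge0 // => lt_e.
rewrite -(subrK (S N) M) addrC; apply: (le_trans (opnormD _ _)).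
by apply: lerD (SB N) (le_trans (opnorm_le_entrysum _) (ltW lt_e)).
Qed.

End EntrywiseLimits.

(** * Adjoints and unitarily diagonalised matrices *)

Section Adjoint.
Variable C : numClosedFieldType.
Local Open Scope sesquilinear_scope.

Lemma adjM m n p (A : 'M[C]_(m, n)) (B : 'M[C]_(n, p)) : (A *m B) ^t* = B ^t* *m A ^t*.
Proof. by rewrite trmx_mul map_mxM. Qed.

Lemma adjD m n (A B : 'M[C]_(m, n)) : (A + B) ^t* = A ^t* + B ^t*.
Proof. by rewrite linearD map_mxD. Qed.

Lemma adjZ m n a (A : 'M[C]_(m, n)) : (a *: A) ^t* = a^* *: A ^t*.
Proof. by rewrite linearZ map_mxZ. Qed.

Lemma adj0 m n : (0 : 'M[C]_(m, n)) ^t* = 0.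
Proof. by rewrite trmx0 map_mx0. Qed.

Lemma adj_diag n (d : 'rV[C]_n) : (diag_mx d) ^t* = diag_mx (map_mx Num.conj d).
Proof. by rewrite tr_diag_mx map_diag_mx. Qed.

Definition unidiag n (P : 'M[C]_n) (d : 'rV[C]_n) : 'M[C]_n := P ^t* *m diag_mx d *m P.

Lemma unitary_mulVmx n (P : 'M[C]_n) : P \is unitarymx -> P ^t* *m P = 1%:M.
Proof. by move=> uP; rewrite -invmx_unitary // mulVmx // unitarymx_unit. Qed.

Lemma hermitian_unidiag n (A : 'M[C]_n) : A \is hermsymmx ->
  A = unidiag (spectralmx A) (spectral_diag A).
Proof.
move=> /hermitian_normalmx /orthomx_spectralP AE.
by rewrite {1}AE /unidiag invmx_unitary ?spectral_unitarymx.
Qed.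

Lemma unidiagM n (P : 'M[C]_n) d e : P \is unitarymx ->
  unidiag P d *m unidiag P e = unidiag P (\row_i (d 0 i * e 0 i)).
Proof.
move=> uP; rewrite /unidiag !mulmxA mulmxtVK // -[_ *m diag_mx _ *m diag_mx _]mulmxA.
by rewrite mulmx_diag.
Qed.

Lemma unidiag1 n (P : 'M[C]_n) : P \is unitarymx -> unidiag P (const_mx 1) = 1%:M.
Proof. by move=> uP; rewrite /unidiag diag_const_mx mulmx1 unitary_mulVmx. Qed.

Lemma unidiagD n (P : 'M[C]_n) d e : unidiag P d + unidiag P e = unidiag P (d + e).
Proof.
rewrite /unidiag -mulmxDl -mulmxDr; congr (_ *m _ *m _).
by apply/matrixP => i j; rewrite !mxE mulrnDl.
Qed.

Lemma unidiagB n (P : 'M[C]_n) d e : unidiag P d - unidiag P e = unidiag P (d - e).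
Proof.
rewrite /unidiag -mulmxBl -mulmxBr; congr (_ *m _ *m _).
by apply/matrixP => i j; rewrite !mxE mulrnBl.
Qed.

Lemma unidiagZ n (P : 'M[C]_n) c d : c *: unidiag P d = unidiag P (c *: d).
Proof.
rewrite /unidiag scalemxAl scalemxAr; congr (_ *m _ *m _).
by apply/matrixP => i j; rewrite !mxE mulrnAr.
Qed.

Lemma unidiag0 n (P : 'M[C]_n) : unidiag P 0 = 0.
Proof. by rewrite /unidiag linear0 mulmx0 mul0mx. Qed.

Lemma unidiag_adj n (P : 'M[C]_n) d : (unidiag P d) ^t* = unidiag P (map_mx Num.conj d).
Proof. by rewrite /unidiag !adjM trmxCK mulmxA adj_diag. Qed.

Lemma unidiag_form n (P : 'M[C]_n) d (v : 'cV[C]_n) :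
  (v ^t* *m unidiag P d *m v) 0 0 = \sum_i d 0 i * `|(P *m v) i 0| ^+ 2.
Proof.
have -> : v ^t* *m unidiag P d *m v = (P *m v) ^t* *m diag_mx d *m (P *m v).
  by rewrite /unidiag adjM !mulmxA.
rewrite mul_mx_diag mxE; apply: eq_bigr => i _.
by rewrite !mxE normCK mulrAC mulrC; congr (_ * _); rewrite mulrC.
Qed.

(** Commuting with [diag d] forces the entry [(i, j)] to vanish whenever [d_i] and [d_j] differ. On
    the remaining entries [e_i = e_j], so the matrix commutes with [diag e] too. *)
Lemma unidiag_comm n (P B : 'M[C]_n) (d e : 'rV[C]_n) : P \is unitarymx ->
  (forall i j, d 0 i = d 0 j -> e 0 i = e 0 j) ->
  comm_mx B (unidiag P d) -> comm_mx B (unidiag P e).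
Proof.
rewrite /comm_mx => uP de; set X := P *m B *m P ^t*.
have BE : B = P ^t* *m X *m P.
  by rewrite /X !mulmxA unitary_mulVmx // mul1mx -mulmxA unitary_mulVmx // mulmx1.
clearbody X.
have comml f : B *m unidiag P f = P ^t* *m (X *m diag_mx f) *m P.
  by rewrite BE /unidiag !mulmxA mulmxtVK.
have commr f : unidiag P f *m B = P ^t* *m (diag_mx f *m X) *m P.
  by rewrite BE /unidiag !mulmxA mulmxtVK.
rewrite !comml !commr => /(congr1 (fun M => P *m M *m P ^t*)).
rewrite !mulmxA !(unitarymxP uP) !mul1mx !mulmxtVK //.
move=> Xd; congr (_ *m _); rewrite -!mulmxA; congr (_ *m _).
apply/matrixP => i j; move/matrixP: Xd => /(_ i j).
rewrite !mul_mx_diag !mul_diag_mx !mxE => Xd.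
have [eq_d|neq_d] := eqVneq (d 0 i) (d 0 j); first by rewrite (de _ _ eq_d) mulrC.
suff -> : X i j = 0 by rewrite mul0r mulr0.
move/eqP: Xd; rewrite mulrC -subr_eq0 -mulrBl mulf_eq0 subr_eq0 eq_sym (negPf neq_d) /=.
by move/eqP.
Qed.

(** In the eigenbasis, multiplying on both sides by functions of one matrix is an entrywise
    multiplication; conjugation by exponentials thereby becomes scalar calculus. *)
Lemma unidiag_conj n (P Q : 'M[C]_n) (d e : 'rV[C]_n) : P \is unitarymx ->
  unidiag P d *m Q *m unidiag P e
  = P ^t* *m (\matrix_(i, j) (d 0 i * e 0 j * (P *m Q *m P ^t*) i j)) *m P.
Proof.
move=> uP; rewrite /unidiag.
have -> : P ^t* *m diag_mx d *m P *m Q *m (P ^t* *m diag_mx e *m P)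
    = P ^t* *m (diag_mx d *m (P *m Q *m P ^t*) *m diag_mx e) *m P by rewrite !mulmxA.
congr (_ *m _ *m _); apply/matrixP => i j; rewrite mul_mx_diag mul_diag_mx !mxE.
by rewrite mulrAC.
Qed.

End Adjoint.

(** * Functional calculus, exponential and logarithm of self-adjoint matrices *)

Section SpectralCalculus.
Variable R : realType.
Local Notation C := (R[i]).
Local Open Scope sesquilinear_scope.

Lemma selfadjE n (A : 'M[C]_n) : selfadj A <-> A ^t* = A.
Proof. by rewrite /selfadj map_trmx; split => /esym. Qed.

(** Real functional calculus. The function is indexed by the eigenvectors rather than by the
    spectrum, so [g] of [fcalc P d] is [fcalc P (g o d)]. *)
Definition fcalc n (P : 'M[C]_n) (f : 'I_n -> R) : 'M[C]_n :=
  unidiag P (\row_i ((f i)%:C)%C).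

Lemma selfadj_spectral n (A : 'M[C]_n) : selfadj A ->
  exists P (d : 'I_n -> R), P \is unitarymx /\ A = fcalc P d.
Proof.
move=> /selfadjE sA.
have hA : A \is hermsymmx by apply/is_hermitianmxP; rewrite expr0 scale1r sA.
exists (spectralmx A), (fun i => complex.Re (spectral_diag A 0 i)).
split; first exact: spectral_unitarymx.
rewrite {1}(hermitian_unidiag hA) /fcalc; congr (unidiag _ _).
apply/rowP => i; rewrite mxE RRe_real //.
by have /mxOverP := hermitian_spectral_diag_real hA; apply.
Qed.

Lemma fcalcM n (P : 'M[C]_n) f g : P \is unitarymx ->
  fcalc P f *m fcalc P g = fcalc P (fun i => f i * g i).
Proof.
move=> uP; rewrite /fcalc (unidiagM _ _ uP); congr (unidiag P _).
by apply/rowP => i; rewrite !mxE rmorphM.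
Qed.

Lemma fcalc1 n (P : 'M[C]_n) : P \is unitarymx -> fcalc P (fun=> 1) = 1%:M.
Proof.
move=> uP; rewrite -(unidiag1 uP) /fcalc; congr (unidiag P _).
by apply/rowP => i; rewrite !mxE.
Qed.

Lemma fcalcX n (P : 'M[C]_n) f k : P \is unitarymx ->
  fcalc P f ^+ k = fcalc P (fun i => f i ^+ k).
Proof.
move=> uP; elim: k => [|k IH]; first by rewrite expr0 -[LHS](fcalc1 uP).
rewrite exprS IH -[_ * _]/(_ *m _) (fcalcM _ _ uP); congr (fcalc P _).
by apply/funext => i; rewrite exprS.
Qed.

Lemma conjC_real (x : R) : ((x%:C)%C : C)^* = (x%:C)%C.
Proof. by apply/CrealP/complex_realP; exists x. Qed.

Lemma fcalc_selfadj n (P : 'M[C]_n) f : selfadj (fcalc P f).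
Proof.
apply/selfadjE; rewrite /fcalc unidiag_adj; congr (unidiag P _).
by apply/rowP => i; rewrite !mxE conjC_real.
Qed.

Lemma fcalcD n (P : 'M[C]_n) f g : fcalc P f + fcalc P g = fcalc P (fun i => f i + g i).
Proof.
rewrite /fcalc unidiagD; congr (unidiag P _).
by apply/rowP => i; rewrite !mxE rmorphD.
Qed.

Lemma fcalcB n (P : 'M[C]_n) f g : fcalc P f - fcalc P g = fcalc P (fun i => f i - g i).
Proof.
rewrite /fcalc unidiagB; congr (unidiag P _).
by apply/rowP => i; rewrite !mxE rmorphB.
Qed.

Lemma fcalcZ n (P : 'M[C]_n) (c : R) f : (c%:C)%C *: fcalc P f = fcalc P (fun i => c * f i).
Proof.
rewrite /fcalc unidiagZ; congr (unidiag P _).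
by apply/rowP => i; rewrite !mxE rmorphM.
Qed.

Lemma fcalc0 n (P : 'M[C]_n) : fcalc P (fun=> 0) = 0.
Proof.
rewrite -(unidiag0 P) /fcalc; congr (unidiag P _).
by apply/rowP => i; rewrite !mxE.
Qed.

Lemma fcalc_cvg n (P : 'M[C]_n) (f : nat -> 'I_n -> R) (g : 'I_n -> R) :
  (forall i, f k i @[k --> \oo] --> g i) -> mcvg (fun k => fcalc P (f k)) (fcalc P g).
Proof.
move=> fg; rewrite /fcalc /unidiag; apply: mcvg_mulmxr; apply: mcvg_mulmxl => i j.
rewrite !mxE; under [X in ccvg X _]eq_fun do rewrite !mxE.
case: (i == j); first by rewrite mulr1n; exact: ccvg_real.
by rewrite mulr0n; exact: ccvg_cst.
Qed.

(** The partial sums of the matrix series are [fcalc] of the scalar partial sums, so convergence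
    reduces to the real exponential at each eigenvalue. *)
Lemma expm_fcalc n (P : 'M[C]_n) f : P \is unitarymx ->
  expm (fcalc P f) = fcalc P (fun i => expR (f i)).
Proof.
move=> uP; apply: expm_lim.
have -> : exp_psum (fcalc P f) = fun N => fcalc P (fun i => series (exp_coeff (f i)) N).
  apply/funext => N; rewrite /exp_psum; elim: N => [|N IH].
    rewrite big_ord0 -[LHS](fcalc0 P); congr (fcalc P _); apply/funext => i.
    by rewrite /series /= big_geq.
  rewrite big_ord_recr /= IH (fcalcX _ _ uP).
  rewrite (_ : (N`!%:R)^-1 = (((N`!%:R)^-1 : R)%:C)%C); last by rewrite fmorphV rmorph_nat.
  rewrite fcalcZ fcalcD; congr (fcalc P _); apply/funext => i.
  by rewrite /series /= big_nat_recr //= mulrC.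
by apply: fcalc_cvg => i; exact: is_cvg_series_exp_coeff.
Qed.

Lemma fcalc_comm n (P B : 'M[C]_n) (d : 'I_n -> R) (g : R -> R) : P \is unitarymx ->
  comm_mx B (fcalc P d) -> comm_mx B (fcalc P (fun i => g (d i))).
Proof.
by move=> uP; apply: unidiag_comm => // i j; rewrite !mxE => /complexI ->.
Qed.

(** The order on complex numbers makes [0 < z] include that [z] is real. *)
Definition posdef n (M : 'M[C]_n) : Prop :=
  forall v : 'cV[C]_n, v != 0 -> 0 < (v ^t* *m M *m v) 0 0.

Lemma fcalc_posdef n (P : 'M[C]_n) f : P \is unitarymx ->
  (forall i, 0 < f i) -> posdef (fcalc P f).
Proof.
move=> uP f0 v v0; rewrite unidiag_form.
set w := P *m v.
have w0 : w != 0.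
  apply: contra_neq v0 => w0.
  by rewrite -[v]mul1mx -(unitary_mulVmx uP) -mulmxA -/w w0 mulmx0.
clearbody w.
have [i wi] : exists i, w i 0 != 0.
  apply/existsP; apply: contraNT w0; rewrite negb_exists => /forallP w0.
  by apply/eqP/matrixP => i j; rewrite ord1 mxE; apply/eqP; rewrite -[_ == _]negbK.
rewrite (bigD1 i) //= ltr_wpDr //.
  by apply: sumr_ge0 => j _; rewrite !mxE mulr_ge0 ?exprn_ge0 // ler0c ltW.
by rewrite !mxE mulr_gt0 ?ltcR // exprn_gt0 // normr_gt0.
Qed.

(** The quadratic form at the eigenvector [P^* e_i] is the eigenvalue [f i]. *)
Lemma posdef_fcalc_gt0 n (P : 'M[C]_n) f : P \is unitarymx ->
  posdef (fcalc P f) -> forall i, 0 < f i.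
Proof.
move=> uP pd i.
have PPd : P *m (P ^t* *m delta_mx i 0) = delta_mx i 0 :> 'cV_n.
  by rewrite mulmxA (unitarymxP uP) mul1mx.
have v0 : P ^t* *m delta_mx i 0 != 0 :> 'cV_n.
  apply/eqP => /(congr1 (mulmx P)); rewrite PPd mulmx0.
  by move/matrixP/(_ i 0); rewrite !mxE !eqxx => /eqP; rewrite oner_eq0.
have := pd _ v0; rewrite unidiag_form PPd (bigD1 i) //= big1 ?addr0.
  by rewrite !mxE !eqxx /= normr1 expr1n mulr1 ltcR.
by move=> j ji; rewrite [delta_mx i 0 j 0]mxE (negPf ji) normr0 expr0n mulr0.
Qed.

Lemma posdef_log n (M : 'M[C]_n) : selfadj M -> posdef M ->
  exists L, selfadj L /\ expm L = M.
Proof.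
move=> /selfadj_spectral [P [d [uP ->]]] pd.
exists (fcalc P (fun i => ln (d i))); split; first exact: fcalc_selfadj.
rewrite (expm_fcalc _ uP); congr (fcalc P _); apply/funext => i; apply: lnK.
exact: posdef_fcalc_gt0 pd i.
Qed.

Lemma posdef_unitmx n (M : 'M[C]_n) : posdef M -> M \in unitmx.
Proof.
move=> pd; rewrite -unitmx_tr -row_free_unit; apply/inj_row_free => v.
move=> /(congr1 trmx); rewrite trmx_mul trmxK trmx0 => Mv.
apply/eqP; apply: contraT => v0.
have : v^T != 0 by apply: contra_neq v0 => /(congr1 trmx); rewrite trmxK trmx0.
by move=> /pd; rewrite -mulmxA Mv mulmx0 mxE ltxx.
Qed.

Lemma selfadjZ n (c : R) (A : 'M[C]_n) : selfadj A -> selfadj ((c%:C)%C *: A).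
Proof.
rewrite !selfadjE adjZ => ->; congr (_ *: _); exact: conjC_real.
Qed.

End SpectralCalculus.

(** * Iterated commutators *)

Section Commutator.
Variable C : numClosedFieldType.
Local Open Scope sesquilinear_scope.

Definition adm n (K Q : 'M[C]_n) : 'M[C]_n := K *m Q - Q *m K.

(** In the eigenbasis of [K], the map [ad_K] multiplies the entry [(i, j)] by [d_i - d_j]. *)
Lemma iter_adm_unidiag n (P Q : 'M[C]_n) (d : 'rV[C]_n) k : P \is unitarymx ->
  iter k (adm (unidiag P d)) Q
  = P ^t* *m (\matrix_(i, j) ((d 0 i - d 0 j) ^+ k * (P *m Q *m P ^t*) i j)) *m P.
Proof.
move=> uP; elim: k => [|k IH].
  rewrite /= (_ : (\matrix_(i, j) _) = P *m Q *m P ^t*).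
    by rewrite !mulmxA unitary_mulVmx // mul1mx -mulmxA unitary_mulVmx // mulmx1.
  by apply/matrixP => i j; rewrite mxE expr0 mul1r.
rewrite iterS IH; set X := P *m Q *m P ^t*; clearbody X.
set Y := (\matrix_(i, j) _) : 'M[C]_n.
rewrite /adm /unidiag.
have -> : P ^t* *m diag_mx d *m P *m (P ^t* *m Y *m P) = P ^t* *m (diag_mx d *m Y) *m P.
  by rewrite !mulmxA mulmxtVK.
have -> : P ^t* *m Y *m P *m (P ^t* *m diag_mx d *m P) = P ^t* *m (Y *m diag_mx d) *m P.
  by rewrite !mulmxA mulmxtVK.
rewrite -mulmxBl -mulmxBr; congr (_ *m _ *m _).
rewrite mul_diag_mx mul_mx_diag; apply/matrixP => i j; rewrite !mxE exprS.
by ring.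
Qed.

Lemma scale_iter_adm_unidiag n (P Q : 'M[C]_n) (d : 'rV[C]_n) k c : P \is unitarymx ->
  c *: iter k (adm (unidiag P d)) Q
  = P ^t* *m (\matrix_(i, j) (c * (d 0 i - d 0 j) ^+ k * (P *m Q *m P ^t*) i j)) *m P.
Proof.
move=> uP; rewrite iter_adm_unidiag // scalemxAl scalemxAr; congr (_ *m _ *m _).
by apply/matrixP => i j; rewrite !mxE mulrA.
Qed.

Lemma admD n (K Q T : 'M[C]_n) : adm K (Q + T) = adm K Q + adm K T.
Proof. by rewrite /adm mulmxDl mulmxDr opprD addrACA. Qed.

Lemma adm0 n (K : 'M[C]_n) : adm K 0 = 0.
Proof. by rewrite /adm mulmx0 mul0mx subrr. Qed.

Lemma iter_adm_sum n (K : 'M[C]_n) k (I : Type) (r : seq I) (p : pred I) (F : I -> 'M[C]_n) :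
  iter k (adm K) (\sum_(i <- r | p i) F i) = \sum_(i <- r | p i) iter k (adm K) (F i).
Proof.
elim: k => //= k ->; elim/big_rec2: _ => [|i x y _ <-]; first exact: adm0.
by rewrite admD.
Qed.

Lemma adm_suml n (Q : 'M[C]_n) (I : Type) (r : seq I) (p : pred I) (F : I -> 'M[C]_n) :
  adm (\sum_(i <- r | p i) F i) Q = \sum_(i <- r | p i) adm (F i) Q.
Proof. by rewrite /adm mulmx_suml mulmx_sumr -sumrB. Qed.

End Commutator.

(** * One-parameter groups of exponentials and conjugation by them *)

Section Flow.
Variable R : realType.
Local Notation C := (R[i]).
Local Notation normc := ComplexField.Normc.normc.
Local Open Scope sesquilinear_scope.

Lemma expm_spectral n (K : 'M[C]_n) : selfadj K ->
  exists P (d : 'I_n -> R), [/\ P \is unitarymx, K = fcalc P d &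
    forall s : R, expm ((s%:C)%C *: K) = fcalc P (fun i => expR (s * d i))].
Proof.
move=> /selfadj_spectral [P [d [uP ->]]]; exists P, d; split=> [//||s].
  reflexivity.
by rewrite fcalcZ expm_fcalc.
Qed.

Lemma expmD n (K : 'M[C]_n) s t : selfadj K ->
  expm (((s + t)%:C)%C *: K) = expm ((s%:C)%C *: K) *m expm ((t%:C)%C *: K).
Proof.
move=> /expm_spectral [P [d [uP _ E]]]; rewrite !E (fcalcM _ _ uP); congr (fcalc P _).
by apply/funext => i; rewrite mulrDl expRD.
Qed.

Lemma expm0Z n (K : 'M[C]_n) : selfadj K -> expm ((0%:C)%C *: K) = 1%:M.
Proof.
move=> /expm_spectral [P [d [uP _ E]]]; rewrite !E -(fcalc1 uP); congr (fcalc P _).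
by apply/funext => i; rewrite mul0r expR0.
Qed.

Lemma expm_mulN n (K : 'M[C]_n) s : selfadj K ->
  expm ((s%:C)%C *: K) *m expm (((- s)%:C)%C *: K) = 1%:M.
Proof. by move=> sK; rewrite -expmD // subrr expm0Z. Qed.

Lemma expm_natZ n (K : 'M[C]_n) s k : selfadj K ->
  expm (((k%:R * s)%:C)%C *: K) = expm ((s%:C)%C *: K) ^+ k.
Proof.
move=> sK; elim: k => [|k IH]; first by rewrite mul0r expm0Z.
by rewrite exprS -IH -natr1 mulrDl mul1r addrC expmD.
Qed.

Lemma expm_comm n (K B : 'M[C]_n) s : selfadj K ->
  comm_mx B K -> comm_mx B (expm ((s%:C)%C *: K)).
Proof.
move=> /expm_spectral [P [d [uP KE E]]]; rewrite E {1}KE.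
exact: (@fcalc_comm _ _ _ _ _ (fun x => expR (s * x)) uP).
Qed.

Lemma expm_selfadj n (K : 'M[C]_n) s : selfadj K -> selfadj (expm ((s%:C)%C *: K)).
Proof. by move=> /expm_spectral [P [d [uP _ E]]]; rewrite E; exact: fcalc_selfadj. Qed.

Lemma expm_posdef n (K : 'M[C]_n) s : selfadj K -> posdef (expm ((s%:C)%C *: K)).
Proof.
move=> /expm_spectral [P [d [uP _ E]]]; rewrite E.
by apply: fcalc_posdef => // i; exact: expR_gt0.
Qed.

(** A rough bound is enough: it only feeds constants that disappear when the step of the Euler
    scheme tends to 0. *)
Lemma opnorm_fcalc n (P : 'M[C]_n) f :
  opnorm (fcalc P f) <= opnorm (P ^t*) * (\sum_i `|f i|) * opnorm P.
Proof.
apply: (le_trans (opnormM _ _)); rewrite ler_wpM2r ?opnorm_ge0 //.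
apply: (le_trans (opnormM _ _)); rewrite ler_wpM2l ?opnorm_ge0 //.
apply: (le_trans (opnorm_le_entrysum _)); apply: ler_sum => i _.
rewrite (bigD1 i) //= big1 ?addr0.
  by rewrite !mxE eqxx mulr1n normc_real.
by move=> j ji; rewrite !mxE eq_sym (negPf ji) mulr0n ComplexField.Normc.normc0.
Qed.

(** Applying [1 + x <= e^x] at [x] and at [-x] gives [0 <= e^x - 1 - x <= x (e^x - 1)]; the last
    product is then bounded according to the sign of [x]. *)
Lemma expR_taylor1 (x : R) : `|expR x - 1 - x| <= x ^+ 2 * expR `|x|.
Proof.
have e1 : 1 + x <= expR x by exact: expR_ge1Dx.
have e2 : expR x - 1 <= x * expR x.
  have := expR_ge1Dx (- x); rewrite expRN => h.
  have := ler_wpM2r (expR_ge0 x) h; rewrite mulVf ?gt_eqF ?expR_gt0 //.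
  by rewrite mulrDl mul1r mulNr; lra.
rewrite ger0_norm; last by lra.
have [x0|x0] := leP 0 x.
  have := ler_wpM2l x0 e2; rewrite ger0_norm // expr2 -mulrA; lra.
have := ler_wnM2l (ltW x0) e1.
have E1 : 1 <= expR `|x| by have := expR_ge1Dx `|x|; have := normr_ge0 x; lra.
by have := ler_wpM2l (sqr_ge0 x) E1; rewrite mulr1 expr2; lra.
Qed.

Lemma expm_taylor1 n (K : 'M[C]_n) b : selfadj K ->
  exists2 c : R, 0 <= c & forall s : R, `|s| <= b ->
    opnorm (expm ((s%:C)%C *: K) - 1%:M - (s%:C)%C *: K) <= c * s ^+ 2.
Proof.
move=> /expm_spectral [P [d [uP -> E]]].
exists (opnorm (P ^t*) * (\sum_i (d i ^+ 2 * expR (b * `|d i|))) * opnorm P).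
  rewrite !mulr_ge0 ?opnorm_ge0 //; apply: sumr_ge0 => i _.
  by rewrite mulr_ge0 ?sqr_ge0 ?expR_ge0.
move=> s sb.
have -> : expm ((s%:C)%C *: fcalc P d) - 1%:M - (s%:C)%C *: fcalc P d
    = fcalc P (fun i => expR (s * d i) - 1 - s * d i).
  by rewrite E -(fcalc1 uP) fcalcZ !fcalcB.
apply: (le_trans (opnorm_fcalc _ _)).
rewrite [leRHS]mulrAC ler_wpM2r ?opnorm_ge0 // -mulrA ler_wpM2l ?opnorm_ge0 //.
rewrite mulr_suml; apply: ler_sum => i _.
apply: (le_trans (expR_taylor1 _)).
rewrite exprMn [s ^+ 2 * _]mulrC -mulrA -[leRHS]mulrA ler_wpM2l ?sqr_ge0 //.
by rewrite [leRHS]mulrC ler_wpM2l ?sqr_ge0 // ler_expR normrM ler_wpM2r.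
Qed.

Lemma expm_bounded n (K : 'M[C]_n) b : selfadj K ->
  exists2 c : R, 0 <= c & forall s : R, `|s| <= b -> opnorm (expm ((s%:C)%C *: K)) <= c.
Proof.
move=> /expm_spectral [P [d [uP _ E]]].
exists (opnorm (P ^t*) * (\sum_i expR (b * `|d i|)) * opnorm P).
  by rewrite !mulr_ge0 ?opnorm_ge0 //; apply: sumr_ge0 => i _; exact: expR_ge0.
move=> s sb; rewrite E; apply: (le_trans (opnorm_fcalc _ _)).
rewrite ler_wpM2r ?opnorm_ge0 // ler_wpM2l ?opnorm_ge0 //.
apply: ler_sum => i _; rewrite ger0_norm ?expR_ge0 // ler_expR.
by apply: (le_trans (ler_norm _)); rewrite normrM ler_wpM2r.
Qed.

(** The expansion of [e^(-sK) Q e^(sK)] in iterated commutators. At the entry [(i, j)] in the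
    eigenbasis it is the scalar exponential series of [-s (d_i - d_j)]. *)
Lemma expm_conj_cvg n (K Q : 'M[C]_n) s : selfadj K ->
  mcvg (fun N => \sum_(k < N) ((((- s) ^+ k / k`!%:R)%:C)%C *: iter k (adm K) Q))
    (expm (((- s)%:C)%C *: K) *m Q *m expm ((s%:C)%C *: K)).
Proof.
move=> /expm_spectral [P [d [uP -> E]]]; rewrite !E (unidiag_conj _ _ _ uP).
set X := P *m Q *m P ^t*.
pose S N := \matrix_(i, j)
  ((series (exp_coeff (- s * (d i - d j))) N)%:C%C * X i j) : 'M[C]_n.
have -> : (fun N => \sum_(k < N)
    ((((- s) ^+ k / k`!%:R)%:C)%C *: iter k (adm (fcalc P d)) Q))
    = fun N => P ^t* *m S N *m P.
  apply/funext => N; transitivity (P ^t* *m (\sum_(k < N) (\matrix_(i, j)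
      (((- s) ^+ k / k`!%:R * (d i - d j) ^+ k)%:C%C * X i j) : 'M[C]_n)) *m P).
    rewrite mulmx_sumr mulmx_suml; apply: eq_bigr => k _.
    rewrite (scale_iter_adm_unidiag _ _ _ _ uP) -/X; congr (P ^t* *m _ *m P).
    apply/matrixP => i j; rewrite mxE [in RHS]mxE; congr (_ * _).
    by rewrite !mxE -rmorphB -rmorphXn -rmorphM.
  congr (P ^t* *m _ *m P); apply/matrixP => i j; rewrite summxE mxE.
  under eq_bigr do rewrite mxE.
  rewrite -mulr_suml -rmorph_sum /=; congr (_%:C%C * _).
  rewrite /series /= big_mkord; apply: eq_bigr => k _.
  by rewrite /exp_coeff /= exprMn mulrAC.
apply: mcvg_mulmxr; apply: mcvg_mulmxl => i j.
rewrite mxE ![(\row_k _) 0 _]mxE -rmorphM -expRD.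
under [X in ccvg X _]eq_fun do rewrite mxE.
apply: ccvgMr; apply: ccvg_real.
have -> : - s * d i + s * d j = - s * (d i - d j) by ring.
exact: is_cvg_series_exp_coeff.
Qed.

Lemma opnorm_expm_conj n (K Q : 'M[C]_n) s B : selfadj K -> 0 <= s ->
  (forall N, \sum_(k < N) (s ^+ k / k`!%:R * opnorm (iter k (adm K) Q)) <= B) ->
  opnorm (expm (((- s)%:C)%C *: K) *m Q *m expm ((s%:C)%C *: K)) <= B.
Proof.
move=> sK s0 sB; apply: (opnorm_mcvg (expm_conj_cvg Q s sK)) => N.
apply: le_trans (sB N); apply: (le_trans (opnorm_sum _ _ _)).
apply: ler_sum => k _; apply: (le_trans (opnormZr _ _)).
by rewrite normrM normrX normrN (ger0_norm s0) ger0_norm ?invr_ge0.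
Qed.

End Flow.

(** * First-order expansions at the identity and the Euler scheme *)

Section FirstOrder.
Variable R : realType.
Local Notation C := (R[i]).

(** Every summand on the right contains either a remainder of one factor or the product [Y1 Y2],
    hence is of second order. *)
Lemma first_order_mul (F : fieldType) n (T1 T2 Y1 Y2 : 'M[F]_n) :
  T1 *m T2 - 1%:M - (Y1 + Y2)
  = (T1 - 1%:M - Y1) *m T2 + (T2 - 1%:M - Y2)
    + Y1 *m (T2 - 1%:M - Y2) + Y1 *m Y2.
Proof.
rewrite !mulmxBl mul1mx !mulmxBr mulmx1.
move: (T1 *m T2) (Y1 *m T2) (Y1 *m Y2) => A B E.
apply/matrixP => i j; rewrite !mxE; ring.
Qed.

(** The discrete interaction picture: passing from [k] to [k + 1] multiplies [P^k Q^k] on the left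
    by [1 + P^k (P Q - 1) P^(-k)], with [P'] in the role of the inverse of [P]. *)
Lemma power_telescope (F : fieldType) n (P P' Q : 'M[F]_n) k : P' ^+ k *m P ^+ k = 1%:M ->
  P ^+ k.+1 *m Q ^+ k.+1
  = P ^+ k *m Q ^+ k + (P ^+ k *m (P *m Q - 1%:M) *m P' ^+ k) *m (P ^+ k *m Q ^+ k).
Proof.
move=> P'P; rewrite exprSr exprS -[_ * P]/(_ *m _) -[Q * _]/(_ *m _).
rewrite [X in _ + X]mulmxA -(mulmxA _ (P' ^+ k)) P'P mulmx1.
by rewrite mulmxBr mulmx1 mulmxBl addrCA subrr addr0 !mulmxA.
Qed.

(** A curve through the identity with derivative [X] at 0 and a quadratic remainder, uniform on
    [[0, b]]; it stands in for differentiability. *)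
Definition first_order n (b : R) (T : R -> 'M[C]_n) (X : 'M[C]_n) : Prop :=
  exists2 c : R, 0 <= c & forall s : R, 0 <= s <= b ->
    opnorm (T s - 1%:M - (s%:C)%C *: X) <= c * s ^+ 2.

Lemma first_orderM n b (T1 T2 : R -> 'M[C]_n) X1 X2 : 0 <= b ->
  first_order b T1 X1 -> first_order b T2 X2 ->
  first_order b (fun s => T1 s *m T2 s) (X1 + X2).
Proof.
move=> b0 [c1 c10 h1] [c2 c20 h2].
exists (c1 * (c2 * b ^+ 2 + 1 + b * opnorm X2) + c2 + b * opnorm X1 * c2
        + opnorm X1 * opnorm X2).
  by rewrite !addr_ge0 ?mulr_ge0 ?addr_ge0 ?opnorm_ge0 ?mulr_ge0 ?sqr_ge0 ?opnorm_ge0.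
move=> s /andP[s0 sb].
have {}h1 : opnorm (T1 s - 1%:M - (s%:C)%C *: X1) <= c1 * s ^+ 2 by apply: h1; rewrite s0.
have {}h2 : opnorm (T2 s - 1%:M - (s%:C)%C *: X2) <= c2 * s ^+ 2 by apply: h2; rewrite s0.
have hs2 : s ^+ 2 <= b ^+ 2 by rewrite ler_pXn2r ?nnegrE.
have hsX (X : 'M[C]_n) : opnorm ((s%:C)%C *: X) <= s * opnorm X.
  by apply: (le_trans (opnormZr _ _)); rewrite ger0_norm.
have hT2 : opnorm (T2 s) <= c2 * b ^+ 2 + 1 + b * opnorm X2.
  have -> : T2 s = (T2 s - 1%:M - (s%:C)%C *: X2) + 1%:M + (s%:C)%C *: X2.
    by rewrite addrAC subrK subrK.
  apply: (le_trans (opnormD _ _)); apply: lerD; last first.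
    by apply: (le_trans (hsX _)); rewrite ler_wpM2r ?opnorm_ge0.
  apply: (le_trans (opnormD _ _)); apply: lerD; last exact: opnorm1.
  by apply: (le_trans h2); rewrite ler_wpM2l.
rewrite scalerDr first_order_mul.
rewrite !mulrDl; apply: (le_trans (opnormD _ _)); apply: lerD; last first.
  apply: (le_trans (opnormM _ _)).
  have -> : opnorm X1 * opnorm X2 * s ^+ 2 = (s * opnorm X1) * (s * opnorm X2).
    by rewrite [RHS]mulrACA -expr2 mulrC.
  by apply: ler_pM; rewrite ?opnorm_ge0.
apply: (le_trans (opnormD _ _)); apply: lerD; last first.
  apply: (le_trans (opnormM _ _)); rewrite -(mulrA (b * _)); apply: ler_pM; rewrite ?opnorm_ge0 //.
  by apply: (le_trans (hsX _)); rewrite ler_wpM2r ?opnorm_ge0.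
apply: (le_trans (opnormD _ _)); apply: lerD => //.
apply: (le_trans (opnormM _ _)); rewrite mulrAC.
by apply: ler_pM; rewrite ?opnorm_ge0.
Qed.

Lemma first_order_expm n b (K : 'M[C]_n) : selfadj K ->
  first_order b (fun s => expm ((s%:C)%C *: K)) K.
Proof.
move=> sK; have [c c0 h] := expm_taylor1 b sK; exists c => // s /andP[s0 sb].
by apply: h; rewrite ger0_norm.
Qed.

Lemma first_order_expmN n b (K : 'M[C]_n) : selfadj K ->
  first_order b (fun s => expm (((- s)%:C)%C *: K)) (- K).
Proof.
move=> sK; have [c c0 h] := expm_taylor1 b sK; exists c => // s /andP[s0 sb].
have := h (- s); rewrite normrN ger0_norm // sqrrN => /(_ sb).
by rewrite scalerN [in X in _ - X]rmorphN scaleNr.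
Qed.

(* A discrete Duhamel formula: in the interaction picture every step of length b/N
   multiplies by 1 - (b/N) e^{-sK} (K - X) e^{sK} + O(N^-2). *)
Lemma opnorm_interaction_picture n (K X : 'M[C]_n) (T : R -> 'M[C]_n) (b w : R) :
  selfadj K -> 0 < b -> 0 <= w ->
  (forall s k, T (k%:R * s) = T s ^+ k) ->
  first_order b T X ->
  (forall s : R, 0 <= s <= b ->
     opnorm (expm (((- s)%:C)%C *: K) *m (K - X) *m expm ((s%:C)%C *: K)) <= w) ->
  opnorm (expm (((- b)%:C)%C *: K) *m T b - 1%:M) <= expR (b * w) - 1.
Proof.
move=> sK b0 w0 TX hT hw.
have [c c0 hc] := first_orderM (ltW b0) (first_order_expmN b sK) hT.
have [m m0 hm] := expm_bounded b sK.
set Y := opnorm _; have Y0 : 0 <= Y by exact: opnorm_ge0.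
(* With [N + 1] steps the scheme leaves an error of order [1/(N + 1)] in the exponent. Comparing
   logarithms, that error is made smaller than any [e > 0]. *)
suff step N : Y + 1 <= expR (b * w + m ^+ 2 * c * b ^+ 2 / N.+1%:R).
  rewrite lerBrDr -[leLHS]lnK ?posrE ?ltr_wpDl // ler_expR.
  apply/ler_addgt0Pr => e e0.
  pose N := Num.truncn (m ^+ 2 * c * b ^+ 2 / e).
  have : Y + 1 <= expR (b * w + e).
    apply: (le_trans (step N)); rewrite ler_expR lerD2l.
    rewrite ler_pdivrMr ?ltr0n // [leRHS]mulrC -ler_pdivrMr //; apply/ltW/truncnS_gt.
  by rewrite -{1}[Y + 1]lnK ?posrE ?ltr_wpDl // ler_expR.
set d := b / N.+1%:R.
have d0 : 0 <= d by rewrite divr_ge0 // ltW.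
have db : N.+1%:R * d = b by rewrite mulrC divfK // pnatr_eq0.
have [P PX] : exists P : 'M[C]_n, forall k, P ^+ k = expm (((- (k%:R * d))%:C)%C *: K).
  by exists (expm (((- d)%:C)%C *: K)) => k; rewrite -[LHS](expm_natZ (- d) k sK) mulrN.
have [P' P'X] : exists P' : 'M[C]_n, forall k, P' ^+ k = expm (((k%:R * d)%:C)%C *: K).
  by exists (expm ((d%:C)%C *: K)) => k; rewrite -(expm_natZ d k sK).
have PE : P = expm (((- d)%:C)%C *: K) by rewrite -[P]expr1 PX mul1r.
pose Q := T d.
have kd k : (k <= N.+1)%N -> 0 <= k%:R * d <= b.
  move=> kN; rewrite mulr_ge0 //= -[leRHS]db ler_wpM2r // ler_nat //.
(* Size of one conjugated step: [d w] from the first-order part, and the remainder [c d^2] enlarged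
   by two exponentials of norm at most [m]. *)
pose eta := d * w + m ^+ 2 * c * d ^+ 2.
have eta0 : 0 <= eta.
  by apply: addr_ge0; apply: mulr_ge0; rewrite ?mulr_ge0 ?sqr_ge0 // (ltW b0).
have conj_le k : (k <= N.+1)%N ->
    opnorm (P ^+ k *m (P *m Q - 1%:M) *m P' ^+ k) <= eta.
  move=> kN; have /andP[kd0 kdb] := kd k kN; rewrite PX P'X.
  set G := P *m Q - 1%:M.
  have -> : G = - ((d%:C)%C *: (K - X)) + (G - (d%:C)%C *: (- K + X)).
    by rewrite -scalerN opprB [- K + X]addrC [RHS]addrC subrK.
  rewrite mulmxDr mulmxDl; apply: (le_trans (opnormD _ _)); apply: lerD.
    rewrite mulmxN mulNmx; apply: (le_trans (opnormN _)).
    rewrite -scalemxAr -scalemxAl; apply: (le_trans (opnormZr _ _)).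
    by rewrite ger0_norm // ler_wpM2l // hw // kd0.
  apply: (le_trans (opnormM _ _)).
  have -> : m ^+ 2 * c * d ^+ 2 = m * (c * d ^+ 2) * m by ring.
  apply: ler_pM; rewrite ?opnorm_ge0 //; last by apply: hm; rewrite ger0_norm.
  apply: (le_trans (opnormM _ _)).
  apply: ler_pM; rewrite ?opnorm_ge0 //; first by apply: hm; rewrite normrN ger0_norm.
  by rewrite /G PE; apply: hc; rewrite d0 /= -db ler_peMl // ler1n.
(* The induction hypothesis is used twice: for the distance of [U] to the identity, and through it
   for the bound [(1 + eta)^k] on the norm of [U], which multiplies the new increment. *)
have U_le k : (k <= N.+1)%N -> opnorm (P ^+ k *m Q ^+ k - 1%:M) <= (1 + eta) ^+ k - 1.
  elim: k => [_|k IH kN].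
    by rewrite !expr0 -[1 *m 1]/(1 * 1) mulr1 !subrr opnorm0.
  have PP : P' ^+ k *m P ^+ k = 1%:M by rewrite PX P'X expm_mulN.
  rewrite (power_telescope _ PP) addrAC.
  have {}IH := IH (ltnW kN); set U := P ^+ k *m Q ^+ k in IH *.
  apply: (le_trans (opnormD _ _)).
  have U1 : opnorm U <= (1 + eta) ^+ k.
    rewrite -(subrK 1%:M U); apply: (le_trans (opnormD _ _)).
    by rewrite -lerBrDr; apply: le_trans IH _; rewrite lerD2l lerN2 opnorm1.
  have -> : (1 + eta) ^+ k.+1 - 1 = ((1 + eta) ^+ k - 1) + eta * (1 + eta) ^+ k.
    by rewrite exprS; ring.
  apply: lerD IH _; apply: (le_trans (opnormM _ _)).
  by apply: ler_pM; rewrite ?opnorm_ge0 // conj_le // ltnW.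
have := U_le N.+1 (leqnn _); rewrite PX -TX db -/Y lerBrDr => /le_trans -> //.
have -> : b * w + m ^+ 2 * c * b ^+ 2 / N.+1%:R = N.+1%:R * eta.
  have : N.+1%:R != 0 :> R by rewrite pnatr_eq0.
  by rewrite /eta /d; move: (N.+1%:R) => q q0; field.
rewrite expRM_natl; apply: lerXn2r; last exact: expR_ge1Dx.
  by rewrite nnegrE addr_ge0.
by rewrite nnegrE expR_ge0.
Qed.

End FirstOrder.

(** * Families of isometries with orthogonal ranges *)

Section IsometryFamily.
Variables (C : numClosedFieldType) (I : finType) (N m : nat) (J : I -> 'M[C]_(N, m)).
Local Open Scope sesquilinear_scope.
Hypothesis JJ : forall r r', (J r) ^t* *m J r' = (r == r')%:R%:M.

Definition amplify (Q : 'M[C]_m) : 'M[C]_N := \sum_r J r *m Q *m (J r) ^t*.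
Definition compress (Q : 'M[C]_N) : 'M[C]_m := \sum_r (J r) ^t* *m Q *m J r.

(** Orthogonality of the ranges kills all terms but one. This intertwining makes [amplify]
    multiplicative and norm preserving. *)
Lemma amplify_intertwine Q r : amplify Q *m J r = J r *m Q.
Proof.
rewrite /amplify mulmx_suml (bigD1 r) //= big1 ?addr0.
  by rewrite -mulmxA JJ eqxx mulmx1.
by move=> r' rr'; rewrite -mulmxA JJ (negPf rr') -scalemx1 scale0r mulmx0.
Qed.

Lemma amplify_cointertwine Q r : (J r) ^t* *m amplify Q = Q *m (J r) ^t*.
Proof.
rewrite /amplify mulmx_sumr (bigD1 r) //= big1 ?addr0.
  by rewrite !mulmxA JJ eqxx mul1mx.
by move=> r' rr'; rewrite !mulmxA JJ eq_sym (negPf rr') -scalemx1 scale0r !mul0mx.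
Qed.

Lemma amplifyM Q T : amplify (Q *m T) = amplify Q *m amplify T.
Proof.
rewrite [amplify T]/amplify mulmx_sumr; apply: eq_bigr => r _.
by rewrite !mulmxA amplify_intertwine.
Qed.

Lemma amplifyD Q T : amplify (Q + T) = amplify Q + amplify T.
Proof. by rewrite -big_split; apply: eq_bigr => r _; rewrite /= mulmxDr mulmxDl. Qed.

Lemma amplifyZ c Q : amplify (c *: Q) = c *: amplify Q.
Proof. by rewrite scaler_sumr; apply: eq_bigr => r _; rewrite -scalemxAr -scalemxAl. Qed.

Lemma amplify_adj Q : (amplify Q) ^t* = amplify (Q ^t*).
Proof.
rewrite /amplify raddf_sum map_mx_sum; apply: eq_bigr => r _.
by rewrite !adjM trmxCK mulmxA.
Qed.

Lemma compress_adj Q : (compress Q) ^t* = compress (Q ^t*).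
Proof.
rewrite /compress raddf_sum map_mx_sum; apply: eq_bigr => r _.
by rewrite !adjM trmxCK mulmxA.
Qed.

Lemma compressZ c Q : compress (c *: Q) = c *: compress Q.
Proof. by rewrite scaler_sumr; apply: eq_bigr => r _; rewrite -scalemxAr -scalemxAl. Qed.

Lemma compress_form Q (v : 'cV[C]_m) :
  (v ^t* *m compress Q *m v) 0 0 = \sum_r ((J r *m v) ^t* *m Q *m (J r *m v)) 0 0.
Proof.
rewrite /compress mulmx_sumr mulmx_suml summxE; apply: eq_bigr => r _.
by rewrite adjM !mulmxA.
Qed.

Lemma isometry_neq0 (v : 'cV[C]_m) r : v != 0 -> J r *m v != 0.
Proof.
apply: contra_neq => Jv.
have : (J r) ^t* *m J r *m v = v by rewrite JJ eqxx mul1mx.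
by rewrite -mulmxA Jv mulmx0 => <-.
Qed.

Lemma isometry_form (v : 'cV[C]_m) r : (J r *m v) ^t* *m (J r *m v) = v ^t* *m v.
Proof. by rewrite adjM mulmxA -(mulmxA _ _ (J r)) JJ eqxx mulmx1. Qed.

Hypothesis sumJJ : \sum_r J r *m (J r) ^t* = 1%:M.

Lemma amplify1 : amplify 1%:M = 1%:M.
Proof. by rewrite -sumJJ; apply: eq_bigr => r _; rewrite mulmx1. Qed.

Lemma coisometry_form (v : 'cV[C]_N) :
  (v ^t* *m v) 0 0 = \sum_r (((J r) ^t* *m v) ^t* *m ((J r) ^t* *m v)) 0 0.
Proof.
rewrite -{2}[v]mul1mx -sumJJ mulmx_suml mulmx_sumr summxE; apply: eq_bigr => r _.
by rewrite adjM trmxCK !mulmxA.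
Qed.

End IsometryFamily.

Section IsometryNorm.
Variable R : realType.
Local Notation C := (R[i]).
Local Open Scope sesquilinear_scope.

Lemma sqr_vnorm_form n (v : 'cV[C]_n) : ((vnorm v ^+ 2)%:C)%C = (v ^t* *m v) 0 0.
Proof.
rewrite sqr_vnorm rmorph_sum mxE; apply: eq_bigr => i _.
by rewrite sqr_normc_ReIm [LHS]add_Re2_Im2 !mxE normCK mulrC.
Qed.

Variables (I : finType) (N m : nat) (J : I -> 'M[C]_(N, m)).
Hypothesis JJ : forall r r', (J r) ^t* *m J r' = (r == r')%:R%:M.

Lemma vnorm_isometry (v : 'cV[C]_m) r : vnorm (J r *m v) = vnorm v.
Proof.
apply/eqP; rewrite -(@eqrXn2 _ 2) ?vnorm_ge0 //; apply/eqP; apply: complexI.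
by rewrite !sqr_vnorm_form (isometry_form JJ).
Qed.

(** On the range of a single isometry [J r], the amplification acts as a copy of [Q]. *)
Lemma opnorm_amplify_ge (Q : 'M[C]_m) (r : I) : opnorm Q <= opnorm (amplify J Q).
Proof.
apply: opnorm_le; first exact: opnorm_ge0.
move=> v; rewrite -(vnorm_isometry (Q *m v) r) mulmxA -(amplify_intertwine JJ) -mulmxA.
by apply: (le_trans (opnormP _ _)); rewrite vnorm_isometry.
Qed.

(** The form of the compression is a sum of positive terms over the isometries; the index [r]
    ensures that the sum is not empty. *)
Lemma posdef_compress (Q : 'M[C]_N) (r : I) : posdef Q -> posdef (compress J Q).
Proof.
move=> pd v v0; rewrite compress_form (bigD1 r) //= ltr_wpDr //.
  by apply: sumr_ge0 => r' _; apply: ltW; apply: pd; exact: (isometry_neq0 JJ).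
by apply: pd; exact: (isometry_neq0 JJ).
Qed.

Hypothesis sumJJ : \sum_r J r *m (J r) ^t* = 1%:M.

Lemma sqr_vnorm_coisometry (v : 'cV[C]_N) :
  vnorm v ^+ 2 = \sum_r vnorm ((J r) ^t* *m v) ^+ 2.
Proof.
apply: complexI; rewrite sqr_vnorm_form (coisometry_form sumJJ) rmorph_sum.
by apply: eq_bigr => r _; rewrite -sqr_vnorm_form.
Qed.

(** Pythagoras: the components of a vector in the orthogonal ranges are each acted on by [Q]. *)
Lemma opnorm_amplify_le (Q : 'M[C]_m) : opnorm (amplify J Q) <= opnorm Q.
Proof.
apply: opnorm_le; first exact: opnorm_ge0.
move=> v; rewrite -(@ler_pXn2r _ 2) ?nnegrE ?mulr_ge0 ?opnorm_ge0 ?vnorm_ge0 //.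
rewrite exprMn !sqr_vnorm_coisometry mulr_sumr; apply: ler_sum => r _.
rewrite mulmxA (amplify_cointertwine JJ) -mulmxA -exprMn.
by rewrite ler_pXn2r ?nnegrE ?mulr_ge0 ?opnorm_ge0 ?vnorm_ge0 // opnormP.
Qed.

End IsometryNorm.

(** * Embedding and partial trace of spin operators through isometries *)

Section SpinOperators.
Variables (R : realType) (V : choiceType) (D : nat).
Local Notation C := (R[i]).
Local Notation op := (op R D).
Local Notation conf := (conf D).
Local Open Scope sesquilinear_scope.

Lemma entry_mkop (X : {fset V}) (f : conf X -> conf X -> C) s t : entry (mkop f) s t = f s t.
Proof. by rewrite /entry mxE !enum_rankK. Qed.

Lemma op_ext (X : {fset V}) (A B : op X) : (forall s t, entry A s t = entry B s t) -> A = B.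
Proof.
by move=> AB; apply/matrixP => i j; have := AB (enum_val i) (enum_val j);
  rewrite /entry !enum_valK.
Qed.

Lemma entryM (X : {fset V}) (A B : op X) s t :
  entry (A *m B) s t = \sum_u entry A s u * entry B u t.
Proof.
by rewrite /entry mxE (reindex _ (onW_bij _ (@enum_rank_bij (conf X)))).
Qed.

Section Inclusion.
Variables (X Y : {fset V}) (sXY : (X `<=` Y)%fset).

Definition restr (s : conf Y) : conf X := [ffun x => s (fincl sXY x)].

Lemma agreeOn_restr (a : conf X) (s : conf Y) : agreeOn predT a s = (a == restr s).
Proof.
apply/forallP/eqP => [H|-> x].
  apply/ffunP => x; rewrite ffunE; have /forallP/(_ (fincl sXY x)) := H x.
  by rewrite /= eqxx /= => /eqP.
apply/forallP => y; apply/implyP => /andP[/eqP xy _]; rewrite ffunE; apply/eqP.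
by congr (s _); apply: val_inj; rewrite /= xy.
Qed.

End Inclusion.

(** The configuration of the environment [Y \ X], the index over which the partial trace sums. *)
Definition off (X Y : {fset V}) : conf Y -> conf (Y `\` X)%fset := restr (fsubsetDl Y X).

Lemma agreeOn_off (X Y : {fset V}) (s t : conf Y) :
  agreeOn (fun v => v \notin X) s t = (off X s == off X t).
Proof.
apply/forallP/eqP => [H|st x].
  apply/ffunP => z; rewrite !ffunE.
  have /forallP/(_ (fincl (fsubsetDl Y X) z)) := H (fincl (fsubsetDl Y X) z).
  have := valP z; rewrite in_fsetD => /andP[zX _].
  by rewrite /= eqxx zX /= => /eqP.
apply/forallP => y; apply/implyP => /andP[/eqP xy xX].
have -> : y = x by apply: val_inj; rewrite xy.
have xYX : val x \in (Y `\` X)%fset by rewrite in_fsetD xX (valP x).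
move/ffunP/(_ [` xYX]): st; rewrite !ffunE.
have -> : fincl (fsubsetDl Y X) [` xYX] = x by exact: val_inj.
by move=> ->.
Qed.

Lemma conf_ext (X Y : {fset V}) (sXY : (X `<=` Y)%fset) (s t : conf Y) :
  restr sXY s = restr sXY t -> off X s = off X t -> s = t.
Proof.
move=> /ffunP e1 /ffunP e2; apply/ffunP => y; case: (boolP (val y \in X)) => yX.
  have := e1 [` yX]; rewrite !ffunE.
  suff -> : fincl sXY [` yX] = y by [].
  exact: val_inj.
have yYX : val y \in (Y `\` X)%fset by rewrite in_fsetD yX (valP y).
have := e2 [` yYX]; rewrite !ffunE.
suff -> : fincl (fsubsetDl Y X) [` yYX] = y by [].
exact: val_inj.
Qed.

Lemma conf_join (X Y : {fset V}) (sXY : (X `<=` Y)%fset) (a : conf X) (r : conf (Y `\` X)%fset) :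
  (0 < D)%N -> exists2 s : conf Y, restr sXY s = a & off X s = r.
Proof.
(* A site of [Y] lies in [X] or in [Y \ X], so the last default [Ordinal D0] is never reached. *)
move=> D0; exists [ffun y : Y => if insub (val y) is Some x then a x
  else if insub (val y) is Some z then r z else Ordinal D0].
  by apply/ffunP => x; rewrite !ffunE /= valK.
apply/ffunP => z; rewrite !ffunE /= valK.
by have := valP z; rewrite in_fsetD => /andP[zX _]; rewrite insubN.
Qed.

Lemma entry_embed (X Y : {fset V}) (sXY : (X `<=` Y)%fset) (Q : op X) s t :
  entry (embed Y Q) s t = (off X s == off X t)%:R * entry Q (restr sXY s) (restr sXY t).
Proof.
rewrite entry_mkop agreeOn_off; congr (_ * _).
rewrite (bigD1 (restr sXY s)) //= [X in _ + X]big1 ?addr0.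
  rewrite (bigD1 (restr sXY t)) //= big1 ?addr0.
    by rewrite !(agreeOn_restr sXY) !eqxx mul1r.
  by move=> b /negPf bt; rewrite !(agreeOn_restr sXY) bt andbF mul0r.
by move=> a /negPf b; apply: big1 => b' _; rewrite !(agreeOn_restr sXY) b mul0r.
Qed.

Section Isometries.
Variables (X Y : {fset V}) (sXY : (X `<=` Y)%fset).

Definition spin_isom (r : conf (Y `\` X)%fset) : 'M[C]_(hdim D Y, hdim D X) :=
  \matrix_(i, a) ((a == enum_rank (restr sXY (enum_val i)))
                  && (off X (enum_val i) == r))%:R.

Lemma conjC_natr (n : nat) : (n%:R : C)^* = n%:R.
Proof. exact: rmorph_nat. Qed.

Lemma spin_isom_conj (Q : op X) r i j :
  (spin_isom r *m Q *m (spin_isom r) ^t*) i j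
  = ((off X (enum_val i) == r) && (off X (enum_val j) == r))%:R
    * Q (enum_rank (restr sXY (enum_val i))) (enum_rank (restr sXY (enum_val j))).
Proof.
rewrite mxE (bigD1 (enum_rank (restr sXY (enum_val j)))) //= big1 ?addr0.
  rewrite !mxE eqxx /= conjC_natr.
  rewrite (bigD1 (enum_rank (restr sXY (enum_val i)))) //= big1 ?addr0.
    by rewrite !mxE eqxx /= mulrAC -natrM mulnb.
  by move=> k /negPf ki; rewrite !mxE ki mul0r.
by move=> k /negPf kj; rewrite !mxE kj conjC_natr mulr0.
Qed.

Lemma sum_eq_indicator (T : finType) (x y : T) :
  \sum_r ((x == r) && (y == r))%:R = (x == y)%:R :> C.
Proof.
rewrite (bigD1 x) //= eqxx /= big1 ?addr0; first by rewrite eq_sym.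
by move=> r /negPf rx; rewrite eq_sym rx.
Qed.

(** Summing over [r] the indicator that both environments equal [r] leaves the indicator that they
    coincide, which is the identity factor of the tensor product. *)
Lemma embed_amplify (Q : op X) : embed Y Q = amplify spin_isom Q.
Proof.
apply: op_ext => s t; rewrite (entry_embed sXY) /entry /amplify summxE.
under eq_bigr do rewrite spin_isom_conj !enum_rankK.
by rewrite -mulr_suml sum_eq_indicator.
Qed.

Lemma spin_isom_sum : \sum_r spin_isom r *m (spin_isom r) ^t* = 1%:M.
Proof.
transitivity (amplify spin_isom 1%:M); first by apply: eq_bigr => r _; rewrite mulmx1.
rewrite -embed_amplify; apply: op_ext => s t; rewrite (entry_embed sXY) /entry !mxE.
rewrite -natrM mulnb; congr (_%:R); congr nat_of_bool.
rewrite !(inj_eq enum_rank_inj); apply/andP/eqP => [[/eqP so /eqP sr]|->] //.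
exact: conf_ext sr so.
Qed.

Lemma spin_isom_orthonormal : (0 < D)%N -> forall r r',
  (spin_isom r) ^t* *m spin_isom r' = (r == r')%:R%:M.
Proof.
move=> D0 r r'; apply/matrixP => a b; rewrite mxE.
under eq_bigr do rewrite !mxE conjC_natr -natrM mulnb.
rewrite [RHS]mxE -[RHS]mulr_natr -natrM mulnb.
have [s sa sr] := conf_join sXY (enum_val a) r D0.
rewrite (bigD1 (enum_rank s)) //= big1 ?addr0.
  by rewrite enum_rankK sa sr enum_valK !eqxx /= andbC [b == a]eq_sym.
move=> i si; apply/eqP; rewrite pnatr_eq0 eqb0; apply: contra si.
move=> /andP[/andP[/eqP ai /eqP ri] _]; apply/eqP; rewrite -(enum_valK i); congr enum_rank.
by apply: (@conf_ext _ _ sXY); rewrite ?ri ?sr // sa ai enum_rankK.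
Qed.

(** Agreement of the two environments is split according to their common value [r]; the three sums
    are then exchanged. *)
Lemma ptrace_compress (Q : op Y) : ptrace X Q = compress spin_isom Q.
Proof.
apply: op_ext => a b; rewrite entry_mkop /entry /compress summxE.
transitivity (\sum_(r : conf (Y `\` X)%fset) \sum_(s : conf Y) \sum_(t : conf Y)
   ((a == restr sXY s) && (b == restr sXY t))%:R
   * ((off X s == r) && (off X t == r))%:R * entry Q s t).
  rewrite [RHS]exchange_big; apply: eq_bigr => s _; rewrite [RHS]exchange_big; apply: eq_bigr => t _.
  rewrite -mulr_suml -mulr_sumr sum_eq_indicator !(agreeOn_restr sXY) agreeOn_off.
  by rewrite -natrM mulnb.
apply: eq_bigr => r _; rewrite -mulmxA mxE.
rewrite (reindex _ (onW_bij _ (@enum_rank_bij (conf Y)))); apply: eq_bigr => s _.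
rewrite !mxE conjC_natr enum_rankK (inj_eq enum_rank_inj) mulr_sumr.
rewrite (reindex _ (onW_bij _ (@enum_rank_bij (conf Y)))); apply: eq_bigr => t _.
rewrite !mxE enum_rankK (inj_eq enum_rank_inj) /entry.
rewrite -natrM mulnb [X in _ = _ * X]mulrC mulrA -natrM mulnb; congr (_%:R * _).
by congr nat_of_bool; rewrite andbACA.
Qed.

End Isometries.
End SpinOperators.

(** * Algebraic properties of the embedding *)

Section SpinEmbedding.
Variables (R : realType) (V : choiceType) (D : nat).
Hypothesis D0 : (0 < D)%N.
Local Notation C := (R[i]).
Local Notation op := (op R D).
Local Notation conf := (conf D).
Local Open Scope sesquilinear_scope.

Lemma off_eqP (X Y : {fset V}) (s t : conf Y) :
  reflect (forall y : Y, val y \notin X -> s y = t y) (off X s == off X t).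
Proof.
rewrite -agreeOn_off; apply: (iffP forallP) => [H y yX|H x].
  by have /forallP/(_ y) := H y; rewrite eqxx yX /= => /eqP.
apply/forallP => y; apply/implyP => /andP[/eqP xy xX].
have -> : y = x by apply: val_inj; rewrite xy.
by rewrite H.
Qed.

Section Inclusion.
Variables (X Y : {fset V}) (sXY : (X `<=` Y)%fset).

Lemma embedM (Q T : op X) : embed Y (Q *m T) = embed Y Q *m embed Y T.
Proof.
by rewrite !(embed_amplify sXY) (amplifyM (@spin_isom_orthonormal R _ _ _ _ sXY D0)).
Qed.

Lemma embed1 : embed Y (1%:M : op X) = 1%:M.
Proof. by rewrite (embed_amplify sXY) (amplify1 (spin_isom_sum _ _ sXY)). Qed.

Lemma embedD (Q T : op X) : embed Y (Q + T) = embed Y Q + embed Y T.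
Proof. by rewrite !(embed_amplify sXY) amplifyD. Qed.

Lemma embedZ c (Q : op X) : embed Y (c *: Q) = c *: embed Y Q.
Proof. by rewrite !(embed_amplify sXY) amplifyZ. Qed.

Lemma embedN (Q : op X) : embed Y (- Q) = - embed Y Q.
Proof. by rewrite -scaleN1r embedZ scaleN1r. Qed.

Lemma embedB (Q T : op X) : embed Y (Q - T) = embed Y Q - embed Y T.
Proof. by rewrite embedD embedN. Qed.

Lemma embed0 : embed Y (0 : op X) = 0.
Proof. by rewrite -(scale0r 0) embedZ scale0r. Qed.

Lemma embed_selfadj (Q : op X) : selfadj Q -> selfadj (embed Y Q).
Proof. by move/selfadjE => sQ; apply/selfadjE; rewrite (embed_amplify sXY) amplify_adj sQ. Qed.

Lemma embedX (Q : op X) k : embed Y (Q ^+ k) = embed Y Q ^+ k.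
Proof.
elim: k => [|k IH]; first by rewrite !expr0 -[1]/(1%:M) embed1.
by rewrite !exprS -[Q * _]/(_ *m _) embedM IH.
Qed.

(** Supplies the environment index asked for by the lower norm bound and by strict positivity; it
    exists because [D] is positive. *)
Lemma conf_witness : exists r : conf (Y `\` X)%fset, True.
Proof. by exists [ffun=> Ordinal D0]. Qed.

Lemma opnorm_embed (Q : op X) : opnorm (embed Y Q) = opnorm Q.
Proof.
have [r _] := conf_witness; have oJ := @spin_isom_orthonormal R _ _ _ _ sXY D0.
apply/eqP; rewrite (embed_amplify sXY) eq_le (opnorm_amplify_ge oJ _ r) andbT.
exact: (opnorm_amplify_le oJ (spin_isom_sum _ _ sXY)).
Qed.

Lemma ptrace_posdef (Q : op Y) : posdef Q -> posdef (ptrace X Q).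
Proof.
have [r _] := conf_witness; rewrite (ptrace_compress sXY).
exact: posdef_compress (@spin_isom_orthonormal R _ _ _ _ sXY D0) _ r.
Qed.

Lemma ptrace_selfadj (Q : op Y) : selfadj Q -> selfadj (ptrace X Q).
Proof.
by move/selfadjE => sQ; apply/selfadjE; rewrite (ptrace_compress sXY) compress_adj sQ.
Qed.

Lemma ptraceZ c (Q : op Y) : ptrace X (c *: Q) = c *: ptrace X Q.
Proof. by rewrite !(ptrace_compress sXY) compressZ. Qed.

Lemma embed_exp_psum (Q : op X) N : exp_psum (embed Y Q) N = embed Y (exp_psum Q N).
Proof.
rewrite /exp_psum; elim: N => [|N IH]; first by rewrite !big_ord0 embed0.
by rewrite !big_ord_recr IH embedD embedZ embedX.
Qed.

(** An entry of an embedded operator is an entry of the operator times a fixed 0 or 1, so the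
    partial sums on both sides agree entry by entry, and with them the limits. *)
Lemma embed_expm (Q : op X) : expm (embed Y Q) = embed Y (expm Q).
Proof.
apply: op_ext => s t; rewrite (entry_embed sXY) {1}/entry mxE.
have E N : exp_psum (embed Y Q) N (enum_rank s) (enum_rank t)
    = (off X s == off X t)%:R * entry (exp_psum Q N) (restr sXY s) (restr sXY t).
  by rewrite embed_exp_psum -[LHS]/(entry _ s t) (entry_embed sXY).
under eq_fun do rewrite E; under [X in Complex _ (limn X)]eq_fun do rewrite E.
case: (off X s == off X t) => /=.
  rewrite mul1r /entry mxE; congr (Complex (limn _) (limn _));
    by apply/funext => N; rewrite mul1r.
rewrite mul0r; under eq_fun do rewrite mul0r.
by under [X in Complex _ (limn X)]eq_fun do rewrite mul0r; rewrite !lim_cst.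
Qed.

End Inclusion.

Lemma embed_embed (X Y Z : {fset V}) (Q : op X) : (X `<=` Y)%fset -> (Y `<=` Z)%fset ->
  embed Z (embed Y Q) = embed Z Q.
Proof.
move=> sXY sYZ; have sXZ := fsubset_trans sXY sYZ.
apply: op_ext => s t; rewrite (entry_embed sYZ) (entry_embed sXY) (entry_embed sXZ).
have rr u : restr sXY (restr sYZ u) = restr sXZ u.
  by apply/ffunP => x; rewrite !ffunE; congr (u _); exact: val_inj.
rewrite !rr mulrA -natrM mulnb; congr (_%:R * _); congr nat_of_bool.
apply/andP/off_eqP => [[/off_eqP H1 /off_eqP H2] z zX|H].
  case: (boolP (val z \in Y)) => [zY|/H1 //].
  have := H2 [` zY] zX; rewrite !ffunE.
  suff -> : fincl sYZ [` zY] = z by [].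
  exact: val_inj.
split; apply/off_eqP => y yX; last by rewrite !ffunE H.
by apply: H; apply: contra yX; exact: (fsubsetP sXY).
Qed.

(** In the matrix product the intermediate configuration is forced to be [u0]: it equals [t] on [X1]
    and [s] elsewhere. The result is symmetric in the two factors, whence their commutation. *)
Lemma entry_embed_mul (X1 X2 Y : {fset V}) (s1 : (X1 `<=` Y)%fset) (s2 : (X2 `<=` Y)%fset)
    (Q1 : op X1) (Q2 : op X2) s t : (X1 `&` X2 = fset0)%fset ->
  entry (embed Y Q1 *m embed Y Q2) s t
  = (off (X1 `|` X2)%fset s == off (X1 `|` X2)%fset t)%:R
    * (entry Q1 (restr s1 s) (restr s1 t) * entry Q2 (restr s2 s) (restr s2 t)).
Proof.
move=> /fsetP X12; rewrite entryM.
have disj v : v \in X1 -> v \notin X2.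
  by move=> v1; have := X12 v; rewrite !inE v1 /= => ->.
pose u0 : conf Y := [ffun y => if val y \in X1 then t y else s y].
have uniq_u u : off X1 s == off X1 u -> off X2 u == off X2 t -> u = u0.
  move=> /off_eqP H1 /off_eqP H2; apply/ffunP => y; rewrite ffunE.
  by case: ifPn => [/disj|] yX; [rewrite H2 | rewrite H1].
have E u : entry (embed Y Q1) s u * entry (embed Y Q2) u t
  = ((off X1 s == off X1 u) && (off X2 u == off X2 t))%:R
    * (entry Q1 (restr s1 s) (restr s1 u) * entry Q2 (restr s2 u) (restr s2 t)).
  by rewrite (entry_embed s1) (entry_embed s2) mulrACA -natrM mulnb.
under eq_bigr do rewrite E.
rewrite (bigD1 u0) //= big1 ?addr0; last first.
  move=> u uu0; case: andP => [[h1 h2]|_]; last by rewrite mul0r.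
  by rewrite (uniq_u _ h1 h2) eqxx in uu0.
have -> : restr s1 u0 = restr s1 t by apply/ffunP => x; rewrite !ffunE /= (valP x).
have -> : restr s2 u0 = restr s2 s.
  apply/ffunP => x; rewrite !ffunE /=; case: ifPn => // /disj.
  by rewrite (valP x).
congr (_%:R * _); congr nat_of_bool.
apply/andP/off_eqP => [[/off_eqP H1 /off_eqP H2] y|H].
  rewrite in_fsetU negb_or => /andP[y1 y2]; rewrite H1 // H2 //.
split; apply/off_eqP => y yX; rewrite ffunE; first by rewrite (negPf yX).
by case: ifPn => // y1; apply: H; rewrite in_fsetU negb_or y1.
Qed.

Lemma embed_comm (X1 X2 Y : {fset V}) (Q1 : op X1) (Q2 : op X2) :
  (X1 `<=` Y)%fset -> (X2 `<=` Y)%fset -> (X1 `&` X2 = fset0)%fset ->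
  embed Y Q1 *m embed Y Q2 = embed Y Q2 *m embed Y Q1.
Proof.
move=> s1 s2 X12; apply: op_ext => s t.
rewrite (entry_embed_mul s1 s2) // (entry_embed_mul s2 s1) ?[(X2 `&` X1)%fset]fsetIC //.
by rewrite [(X2 `|` X1)%fset]fsetUC [X in _ * X = _]mulrC.
Qed.

(** Lets the partition function be treated as one more marginal, the one on the empty set. *)
Lemma embed_ptrace_fset0 (Y : {fset V}) (Q : op Y) :
  embed Y (ptrace fset0 Q) = (\tr Q)%:M.
Proof.
have s0 : (fset0 `<=` Y)%fset by exact: fsub0set.
have off0 (s t : conf Y) : (off fset0 s == off fset0 t) = (s == t).
  by apply/off_eqP/eqP => [H|-> //]; apply/ffunP => y; apply: H; rewrite in_fset0.
have uniq0 (a b : conf (fset0 : {fset V})) : a = b.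
  by apply/ffunP => x; have := valP x; rewrite in_fset0.
apply: op_ext => s t; rewrite (entry_embed s0) off0 entry_mkop.
have -> : entry ((\tr Q)%:M : op Y) s t = \tr Q *+ (s == t).
  by rewrite /entry mxE (inj_eq enum_rank_inj).
rewrite mulr_natl; congr (_ *+ _).
transitivity (\sum_(u : conf Y) \sum_(w : conf Y) (u == w)%:R * entry Q u w).
  apply: eq_bigr => u _; apply: eq_bigr => w _; rewrite agreeOn_off off0.
  rewrite !(agreeOn_restr s0) (uniq0 (restr s0 s) (restr s0 u)).
  by rewrite (uniq0 (restr s0 t) (restr s0 w)) !eqxx.
rewrite /mxtrace (reindex _ (onW_bij _ (@enum_rank_bij (conf Y)))).
apply: eq_bigr => u _; rewrite (bigD1 u) //= big1 ?addr0; first by rewrite eqxx mul1r.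
by move=> w /negPf wu; rewrite eq_sym wu mul0r.
Qed.

End SpinEmbedding.

(** * Marginals as exponentials of effective Hamiltonians *)

Section EffectiveHamiltonian.
Variables (R : realType) (V : choiceType) (D : nat).
Hypothesis D0 : (0 < D)%N.
Local Notation C := (R[i]).
Local Notation op := (op R D).
Local Open Scope sesquilinear_scope.

Lemma condexpE (L : set V) (Lam A : {fset V}) (Q : op Lam) : fsetIs Lam L = A ->
  condexp L Q = ((D%:R : C) ^- #|` (Lam `\` A)%fset|) *: embed Lam (ptrace A Q).
Proof.
move=> <-; rewrite /condexp; congr (_ ^- #|` _| *: _).
apply/fsetP => x; rewrite !inE /=.
by case: (x \in Lam); case: (x \in L).
Qed.

Lemma posdefZ n (c : R) (M : 'M[C]_n) : 0 < c -> posdef M -> posdef ((c%:C)%C *: M).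
Proof.
move=> c0 pd v v0; rewrite -scalemxAr -scalemxAl mxE mulr_gt0 ?ltcR //.
exact: pd.
Qed.

(** [slog] has the default value 0, so the existence of a logarithm must be secured. The rescaled
    partial trace is positive definite, hence has one, and the embedding carries it to [Lam]. *)
Lemma condexp_log (L : set V) (Lam : {fset V}) (Q : op Lam) : selfadj Q -> posdef Q ->
  exists M, selfadj M /\ expm M = condexp L Q.
Proof.
move=> sQ pQ.
have sA : (fsetIs Lam L `<=` Lam)%fset by apply/fsubsetP => x; rewrite !inE /= => /andP[].
pose c : R := D%:R ^- #|` fsetDs Lam L|.
have cE : (c%:C)%C = (D%:R : C) ^- #|` fsetDs Lam L|.
  by rewrite /c fmorphV rmorphXn rmorph_nat.
have c0 : 0 < c by rewrite invr_gt0 exprn_gt0 // ltr0n.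
have [M [sM ME]] : exists M, selfadj M /\ expm M = (c%:C)%C *: ptrace (fsetIs Lam L) Q.
  apply: posdef_log; first by apply: selfadjZ; exact: (ptrace_selfadj sA).
  by apply: posdefZ => //; exact: (ptrace_posdef D0 sA).
exists (embed Lam M); split; first exact: (embed_selfadj sA).
by rewrite (embed_expm D0 sA) ME (embedZ sA) /condexp cE.
Qed.

Lemma slogK n (Q : 'M[C]_n) : (exists M, selfadj M /\ expm M = Q) -> expm (slog Q) = Q.
Proof.
by case=> M MQ; have [] := @xgetPex _ 0 [set L | selfadj L /\ expm L = Q] (ex_intro _ M MQ).
Qed.

Lemma ptrace_effective (L : set V) (Lam A : {fset V}) (Q K : op Lam) (beta : R) :
  0 < beta -> selfadj Q -> posdef Q -> fsetIs Lam L = A ->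
  - ((beta^-1)%:C)%C *: slog (condexp L Q) = K ->
  embed Lam (ptrace A Q)
  = ((D%:R : C) ^+ #|` (Lam `\` A)%fset|) *: expm (((- beta)%:C)%C *: K).
Proof.
move=> b0 sQ pQ LA KE.
have sE : slog (condexp L Q) = ((- beta)%:C)%C *: K.
  rewrite -KE scalerA -[- ((beta^-1)%:C)%C]rmorphN -rmorphM mulrNN mulfV ?gt_eqF //.
  by rewrite scale1r.
rewrite -sE (slogK (condexp_log L sQ pQ)) (condexpE _ LA) scalerA mulfV ?scale1r //.
by rewrite expf_neq0 // pnatr_eq0 -lt0n.
Qed.

End EffectiveHamiltonian.

(** * Iterated commutators with a local Hamiltonian *)

Section Locality.
Variables (R : realType) (V : choiceType) (D : nat).
Hypothesis D0 : (0 < D)%N.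
Local Notation C := (R[i]).
Local Notation op := (op R D).

(** A union bound: each [X] meeting [A] is counted at least once on the right, at a common point. *)
Lemma sum_meeting (P : seq {fset V}) (A : {fset V}) (F : {fset V} -> R) :
  (forall X, 0 <= F X) ->
  \sum_(X <- P | (X `&` A)%fset != fset0) F X <= \sum_(x <- A) \sum_(X <- P | x \in X) F X.
Proof.
move=> F0; rewrite (exchange_big_dep xpredT) //= big_mkcond; apply: ler_sum => X _.
case: ifPn => [/fset0Pn [x]|_]; last by apply: sumr_ge0.
rewrite in_fsetI => /andP[xX xA].
by rewrite big_mkcond (big_rem x) //= xX lerDl; apply: sumr_ge0 => y _; case: ifP.
Qed.

Lemma opnorm_adm n (K Q : 'M[C]_n) : opnorm (adm K Q) <= 2 * opnorm K * opnorm Q.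
Proof.
apply: (le_trans (opnormB _ _)).
have -> : 2 * opnorm K * opnorm Q = opnorm K * opnorm Q + opnorm Q * opnorm K.
  by move: (opnorm K) (opnorm Q) => a b; ring.
by apply: lerD; exact: opnormM.
Qed.

(** [k^k / k!] is one term of the series of [e^k]. *)
Lemma powk_le_fact (k : nat) : (k%:R : R) ^+ k * expR (- k%:R) <= k`!%:R.
Proof.
rewrite expRN ler_pdivrMr ?expR_gt0 //; case: k => [|k].
  by rewrite expr0 expR0 mulr1.
have := @expR_ge1Dxn R k.+1%:R k (ler0n _ _) => h.
have : k.+1%:R ^+ k.+1 / k.+1`!%:R <= expR (k.+1%:R : R) by apply: le_trans h; rewrite lerDr.
by rewrite ler_pdivrMr ?ltr0n ?fact_gt0 // mulrC.
Qed.

Section Chain.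
Variables (Lam : {fset V}) (Psi : forall X : {fset V}, op X) (lambda Delta : R).
Hypotheses (lambda0 : 0 < lambda) (Delta0 : 0 < Delta).
Hypothesis PsiD : forall x,
  \sum_(X <- fpowerset Lam | x \in X) opnorm (Psi X) * expR (lambda * #|` X|%:R) <= Delta.
Let K : op Lam := \sum_(X <- fpowerset Lam) embed Lam (Psi X).

(** A commutator of operators on [X] and [Z] is again local, on the union; this keeps the induction
    on commutators within embedded operators. *)
Lemma adm_embed (X Z : {fset V}) (Q : op X) (T : op Z) :
  (X `<=` Lam)%fset -> (Z `<=` Lam)%fset ->
  adm (embed Lam T) (embed Lam Q)
  = embed Lam (adm (embed (X `|` Z)%fset T) (embed (X `|` Z)%fset Q)).
Proof.
move=> sX sZ; have sU : (X `|` Z `<=` Lam)%fset by rewrite fsubUset sX.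
have sXU : (X `<=` X `|` Z)%fset by exact: fsubsetUl.
have sZU : (Z `<=` X `|` Z)%fset by exact: fsubsetUr.
rewrite /adm (embedB sU) !(embedM D0 sU).
by rewrite !(embed_embed _ sXU sU) !(embed_embed _ sZU sU).
Qed.

(* Distributing the exponential weight evenly over the k commutators:
   each one costs a factor |X| <= e^(eps |X|) / (e eps). *)
Lemma opnorm_iter_adm_eps k (eps : R) (X : {fset V}) (Q : op X) : 0 < eps ->
  k%:R * eps <= lambda -> (X `<=` Lam)%fset ->
  opnorm (iter k (adm K) (embed Lam Q))
  <= opnorm Q * (2 * Delta / eps * expR (- 1)) ^+ k * expR (k%:R * eps * #|` X|%:R).
Proof.
move=> eps0; set c := _ * expR (-1).
have c0 : 0 <= c by rewrite mulr_ge0 ?expR_ge0 // divr_ge0 ?mulr_ge0 ?ltW.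
elim: k X Q => [|k IH] X Q kl sX.
  by rewrite /= expr0 !mul0r expR0 !mulr1 (opnorm_embed D0 sX).
have kl' : k%:R * eps <= lambda by apply: le_trans kl; rewrite ler_wpM2r ?(ltW eps0) // ler_nat.
have ke0 : 0 <= k%:R * eps by rewrite mulr_ge0 // ltW.
have disj Z : (Z `<=` Lam)%fset -> (Z `&` X)%fset = fset0 ->
    adm (embed Lam (Psi Z)) (embed Lam Q) = 0.
  by move=> sZ ZX; rewrite /adm (embed_comm (Psi Z) Q sZ sX ZX) subrr.
(* The innermost commutator is split off, so that the induction hypothesis applies to operators on
   the union of [X] and [Z]. Only the [Z] meeting [X] contribute. *)
have -> : iter k.+1 (adm K) (embed Lam Q) = \sum_(Z <- fpowerset Lam | (Z `&` X)%fset != fset0)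
    iter k (adm K) (adm (embed Lam (Psi Z)) (embed Lam Q)).
  rewrite iterSr -iter_adm_sum; congr (iter k _ _).
  rewrite {1}/K adm_suml [RHS]big_mkcond; apply: eq_big_seq => Z /=.
  by rewrite fpowersetE => sZ; case: eqP => // /(disj _ sZ).
apply: (le_trans (opnorm_sum _ _ _)).
pose B := 2 * opnorm Q * c ^+ k * expR (k%:R * eps * #|` X|%:R).
have B0 : 0 <= B by rewrite !mulr_ge0 ?opnorm_ge0 ?expR_ge0 ?exprn_ge0.
apply: (@le_trans _ _ (\sum_(Z <- fpowerset Lam | (Z `&` X)%fset != fset0)
    B * (opnorm (Psi Z) * expR (lambda * #|` Z|%:R)))).
  rewrite big_seq_cond [leRHS]big_seq_cond; apply: ler_sum => Z /andP[].
  rewrite fpowersetE => sZ _; rewrite (adm_embed _ _ sX sZ).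
  have sU : (X `|` Z `<=` Lam)%fset by rewrite fsubUset sX.
  apply: (le_trans (IH _ _ kl' sU)).
  have nQ : opnorm (adm (embed (X `|` Z)%fset (Psi Z)) (embed (X `|` Z)%fset Q))
      <= 2 * opnorm (Psi Z) * opnorm Q.
    apply: (le_trans (opnorm_adm _ _)).
    by rewrite (opnorm_embed D0 (fsubsetUl X Z)) (opnorm_embed D0 (fsubsetUr X Z)).
  have cardU : (#|` (X `|` Z)%fset|%:R : R) <= #|` X|%:R + #|` Z|%:R.
    by rewrite -natrD ler_nat -cardfsUI leq_addr.
  (* The growth of the support by [Z] costs at most [e^(k eps |Z|)], which the weight
     [e^(lambda |Z|)] of the interaction pays for since [k eps <= lambda]. *)
  have eU : expR (k%:R * eps * #|` (X `|` Z)%fset|%:R)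
      <= expR (k%:R * eps * #|` X|%:R) * expR (lambda * #|` Z|%:R).
    rewrite -expRD ler_expR; apply: (le_trans (ler_wpM2l ke0 cardU)).
    by rewrite mulrDr lerD2l ler_wpM2r.
  have -> : B * (opnorm (Psi Z) * expR (lambda * #|` Z|%:R))
     = (2 * opnorm (Psi Z) * opnorm Q) * c ^+ k
       * (expR (k%:R * eps * #|` X|%:R) * expR (lambda * #|` Z|%:R)).
    rewrite /B; move: (opnorm Q) (opnorm (Psi Z)) (expR _) (expR _) (c ^+ k) => a b e f g.
    by ring.
  apply: ler_pM => //; rewrite ?mulr_ge0 ?opnorm_ge0 ?exprn_ge0 ?expR_ge0 //.
  by rewrite ler_wpM2r // exprn_ge0.
rewrite -mulr_sumr.
apply: (@le_trans _ _ (B * (#|` X|%:R * Delta))).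
  apply: ler_wpM2l => //; apply: (le_trans (sum_meeting _ _ _)).
    by move=> Z; rewrite mulr_ge0 ?opnorm_ge0 ?expR_ge0.
  apply: (@le_trans _ _ (\sum_(x <- X) Delta)); first by apply: ler_sum => x _; exact: PsiD.
  by rewrite big_const_seq count_predT iter_addr_0 mulr_natl.
(* This is [1 + t <= e^t] at [t = eps |X| - 1]. *)
have Xle : #|` X|%:R <= expR (eps * #|` X|%:R) * (eps^-1 * expR (- 1)).
  have := expR_ge1Dx (eps * #|` X|%:R - 1); rewrite addrC subrK expRD => h.
  by rewrite mulrCA ler_pdivlMl.
have -> : opnorm Q * c ^+ k.+1 * expR (k.+1%:R * eps * #|` X|%:R)
    = B * ((expR (eps * #|` X|%:R) * (eps^-1 * expR (- 1))) * Delta).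
  rewrite -natr1 !mulrDl expRD mul1r exprS {1}/c /B.
  move: (opnorm Q) (expR _) (expR _) (expR _) (c ^+ k) => a b e f g.
  by ring.
by rewrite ler_wpM2l // ler_wpM2r // ltW.
Qed.

(** The choice [eps = lambda / k] spends exactly the weight [e^(lambda |X|)] and leaves the factor
    [(k / e)^k], which is at most [k!]. The case [k = 0] is direct. *)
Lemma opnorm_iter_adm k (X : {fset V}) (Q : op X) : (X `<=` Lam)%fset ->
  opnorm (iter k (adm K) (embed Lam Q))
  <= opnorm Q * expR (lambda * #|` X|%:R) * (k`!%:R * (2 * Delta / lambda) ^+ k).
Proof.
move=> sX; case: k => [|k].
  rewrite /= (opnorm_embed D0 sX) expr0 fact0 !mulr1 ler_peMr ?opnorm_ge0 //.
  by rewrite -[leLHS]expR0 ler_expR mulr_ge0 // ltW.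
have k0 : 0 < k.+1%:R :> R by rewrite ltr0n.
have eps0 : 0 < lambda / k.+1%:R by rewrite divr_gt0.
have kE : k.+1%:R * (lambda / k.+1%:R) = lambda by rewrite mulrC divfK // gt_eqF.
have := @opnorm_iter_adm_eps k.+1 _ X Q eps0; rewrite kE lexx => /(_ isT sX) /le_trans.
apply; rewrite mulrAC ler_wpM2l ?mulr_ge0 ?opnorm_ge0 ?expR_ge0 //.
have -> : 2 * Delta / (lambda / k.+1%:R) * expR (-1)
    = (2 * Delta / lambda) * (k.+1%:R * expR (-1)) by rewrite invf_div; ring.
have r0 : 0 <= 2 * Delta / lambda by rewrite divr_ge0 ?mulr_ge0 ?ltW.
rewrite exprMn mulrC; apply: ler_wpM2r; first exact: exprn_ge0.
by rewrite exprMn -expRM_natl mulrN1 powk_le_fact.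
Qed.

Lemma sum_geometric_le (q : R) N : 0 <= q < 1 -> \sum_(k < N) q ^+ k <= (1 - q)^-1.
Proof.
move=> /andP[q0 q1]; rewrite -[leRHS]mul1r ler_pdivlMr ?subr_gt0 //.
have := subrX1 q N; rewrite -[q ^+ N - 1]opprB -[q - 1]opprB mulNr => /oppr_inj.
by rewrite mulrC => <-; rewrite lerBlDr lerDl exprn_ge0.
Qed.

(** The factor [k!] of the commutator bound cancels the one in the exponential series. What remains
    is a geometric series of ratio [2 Delta beta / lambda < 1], with sum
    [lambda / (lambda - 2 Delta beta)]. *)
Lemma opnorm_conj_local (beta s : R) (X : {fset V}) (Q : op X) :
  selfadj K -> 0 <= s <= beta -> beta < lambda / (2 * Delta) -> (X `<=` Lam)%fset ->
  opnorm (expm (((- s)%:C)%C *: K) *m embed Lam Q *m expm ((s%:C)%C *: K))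
  <= opnorm Q * expR (lambda * #|` X|%:R) * (lambda / (lambda - 2 * Delta * beta)).
Proof.
move=> sK /andP[s0 sb] bl sX; apply: opnorm_expm_conj => // N.
set M := opnorm Q * _; have M0 : 0 <= M by rewrite mulr_ge0 ?opnorm_ge0 ?expR_ge0.
set r := 2 * Delta / lambda; have r0 : 0 <= r by rewrite divr_ge0 ?mulr_ge0 ?ltW.
have D2 : 0 < 2 * Delta by rewrite mulr_gt0.
have b0 : 0 <= beta by exact: le_trans sb.
have br : 0 <= beta * r < 1.
  by rewrite mulr_ge0 //= mulrA ltr_pdivrMr // mul1r -ltr_pdivlMr.
have -> : lambda / (lambda - 2 * Delta * beta) = (1 - beta * r)^-1.
  rewrite /r -[1](@mulfV _ lambda) ?gt_eqF // mulrA -mulrBl invf_div; congr (_ / (_ - _)).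
  by rewrite mulrC.
apply: le_trans (ler_wpM2l M0 (sum_geometric_le N br)); rewrite mulr_sumr.
apply: ler_sum => k _.
have kf0 : 0 < k`!%:R :> R by rewrite ltr0n fact_gt0.
apply: (@le_trans _ _ (s ^+ k / k`!%:R * (M * (k`!%:R * r ^+ k)))).
  apply: ler_wpM2l; last exact: opnorm_iter_adm.
  by rewrite divr_ge0 ?exprn_ge0 // ltW.
have -> : s ^+ k / k`!%:R * (M * (k`!%:R * r ^+ k)) = M * (s * r) ^+ k.
  rewrite (exprMn k s r); move/gt_eqF/negbT: kf0.
  by move: (k`!%:R) (r ^+ k) (s ^+ k) => w u v w0; field.
apply: (ler_wpM2l M0); apply: lerXn2r; last exact: ler_wpM2r.
  by rewrite nnegrE; exact: mulr_ge0.
by rewrite nnegrE; exact: mulr_ge0.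
Qed.

End Chain.
End Locality.

(** * Effective interactions and the decay of their mixed part *)

Section Interactions.
Variables (R : realType) (V : choiceType) (D : nat).
Hypothesis D0 : (0 < D)%N.
Local Notation C := (R[i]).
Local Notation op := (op R D).

(** The [esum] is a supremum over finite subfamilies, and the subsets of [Lam] containing [x] form
    one of them. *)
Lemma esum_fpowerset_le (Lam : {fset V}) (x : V) (f : {fset V} -> R) (Delta : R) :
  (\esum_(X in [set X : {fset V} | x \in X]) (f X)%:E <= Delta%:E)%E ->
  \sum_(X <- fpowerset Lam | x \in X) f X <= Delta.
Proof.
move=> fD; rewrite -lee_fin; apply: le_trans fD; apply: esum_ge.
pose r : seq {fset V} := [seq X : {fset V} <- fpowerset Lam | x \in X].
exists [set` r].
  split; first exact: finite_seq.
  by move=> X /=; rewrite mem_filter => /andP[].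
rewrite -fsbig_seq ?filter_uniq ?fset_uniq // /r big_filter.
by rewrite sumEFin.
Qed.

Lemma diam_ge0 (dist : V -> V -> R) (X : {fset V}) : 0 <= diam dist X.
Proof. exact: bigmax_ge_id. Qed.

Lemma dist_set_le_diam (dist : V -> V -> R) (X B : {fset V}) x y : is_metric dist ->
  x \in X -> y \in X -> y \in B -> dist_set dist x B <= diam dist X.
Proof.
move=> [d0 dsym dtri] xX yX yB.
(* Obtained from the triangle inequality along [u, v, u]; it makes 0 a lower bound for the infimum
   in [dist_set]. *)
have dist_ge0 u v : 0 <= dist u v.
  have := dtri u v u; rewrite (dsym v u).
  by have /d0 -> : u = u by []; rewrite -mulr2n pmulrn_lge0.
apply: (@le_trans _ _ (dist x y)).
  apply: ge_inf; last by exists y.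
  by exists 0 => _ [z _ <-].
rewrite /diam; have xX' : x \in enum_fset X by [].
have yX' : y \in enum_fset X by [].
apply: (bigmax_sup_seq _ _ _ _ _ xX') => //.
exact: (bigmax_sup_seq _ _ _ _ _ yX').
Qed.

Lemma fsetIs_fset (X A : {fset V}) : fsetIs X [set` A] = (X `&` A)%fset.
Proof. by apply/fsetP => x; rewrite !inE /= mem_setE. Qed.

Lemma fsetIs_set0 (X : {fset V}) : fsetIs X set0 = fset0.
Proof. by apply/fsetP => x; rewrite !inE /= in_set0 andbF. Qed.

Lemma comm_interaction (Lam : {fset V}) (Psi Psi' : forall X : {fset V}, op X)
    (S S' : {fset V} -> {fset V}) :
  (forall X, (S X `<=` X)%fset) -> (forall X, (S' X `<=` X)%fset) ->
  (forall X X', (S X `&` S' X' = fset0)%fset) ->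
  (forall X, supported_in (S X) (Psi X)) -> (forall X, supported_in (S' X) (Psi' X)) ->
  comm_mx (\sum_(X <- fpowerset Lam) embed Lam (Psi X))
          (\sum_(X <- fpowerset Lam) embed Lam (Psi' X)).
Proof.
move=> SX SX' SS suppS suppS'; rewrite /comm_mx [RHS]mulmx_sumr mulmx_suml.
apply: eq_big_seq => X; rewrite fpowersetE => XL; rewrite mulmx_sumr mulmx_suml.
apply: eq_big_seq => X'; rewrite fpowersetE => XL'.
have [Q ->] := suppS X; have [Q' ->] := suppS' X'.
rewrite !(embed_embed _ (SX _) XL) !(embed_embed _ (SX' _) XL').
by apply: embed_comm; rewrite ?(fsubset_trans (SX _)) ?(fsubset_trans (SX' _)).
Qed.

(** Inverses are unique, so it suffices that both candidates invert [embed Y M] in the larger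
    algebra, one from each side. *)
Lemma embed_invmx (X Y : {fset V}) (M : op X) (a : C) (P P' : op Y) :
  (X `<=` Y)%fset -> M \in unitmx -> a != 0 -> embed Y M = a *: P -> P *m P' = 1%:M ->
  embed Y (invmx M) = a^-1 *: P'.
Proof.
move=> sXY uM a0 ME PP'.
have M1 : embed Y (invmx M) *m embed Y M = 1%:M by rewrite -(embedM D0 sXY) mulVmx // embed1.
have M2 : embed Y M *m (a^-1 *: P') = 1%:M.
  by rewrite ME -scalemxAr -scalemxAl scalerA mulVf // scale1r.
by rewrite -[LHS]mulmx1 -M2 mulmxA M1 mul1mx.
Qed.

(** Bookkeeping of normalisations: [z] is the partition function and the [d] are powers of [D]. The
    relation [z = d0 P0] converts the leftover scalar into the missing factor [P0]. *)
Lemma scale_cancel (F : fieldType) n (z dU dA dC d0 : F) (PU PA PC P0 : 'M[F]_n) :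
  z != 0 -> dA != 0 -> dC != 0 -> d0 != 0 -> dU * d0 = dA * dC -> z%:M = d0 *: P0 ->
  ((z^-1 * dU) *: PU) *m (((z^-1 * dA)^-1 *: PA) *m ((z^-1 * dC)^-1 *: PC))
  = PU *m (PA *m (PC *m P0)).
Proof.
move=> z0 A0 C0 d00 dd zE.
have -> : P0 = (d0^-1 * z)%:M.
  by rewrite -scale_scalar_mx zE scalerA mulVf // scale1r.
rewrite mul_mx_scalar !(=^~ scalemxAl, =^~ scalemxAr) !scalerA; congr (_ *: _).
have -> : dU = dA * dC / d0 by rewrite -dd mulfK.
by field; rewrite z0 A0 C0 d00.
Qed.

Lemma scale_unitmx (F : fieldType) n (a : F) (M : 'M[F]_n) :
  a != 0 -> M \in unitmx -> a *: M \in unitmx.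
Proof. by move=> a0 uM; rewrite unitmxZ ?unitfE. Qed.

(** If [z] were 0, then so would be [d P], against the invertibility of [P]; the index [i] excludes
    the empty matrix. *)
Lemma scalar_mx_neq0 (F : fieldType) n (z d : F) (P P' : 'M[F]_n) (i : 'I_n) :
  d != 0 -> P *m P' = 1%:M -> z%:M = d *: P -> z != 0.
Proof.
move=> d0 PP' zE; apply: contra_neq d0 => z0.
have := congr1 (mulmx^~ P') zE; rewrite z0 raddf0 mul0mx -scalemxAl PP'.
by move=> /matrixP /(_ i i); rewrite !mxE eqxx mulr1.
Qed.

Lemma expr_mulmx3 (F : fieldType) n (M N P : 'M[F]_n) k :
  comm_mx M N -> comm_mx M P -> comm_mx N P ->
  (M *m (N *m P)) ^+ k = M ^+ k *m (N ^+ k *m P ^+ k).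
Proof.
rewrite /comm_mx => MN MP NP; rewrite -[M *m _]/(M * (N * P)).
by rewrite exprMn_comm ?exprMn_comm //; exact: commrM.
Qed.

Lemma expR_sub1_le (y : R) : expR y - 1 <= expR y * y.
Proof.
have := ler_wpM2l (expR_ge0 y) (expR_ge1Dx (- y)).
by rewrite expRN mulfV ?gt_eqF ?expR_gt0 // mulrDr mulr1 mulrN; lra.
Qed.

Section EffectiveInteraction.
Variables (dist : V -> V -> R) (Phit : set V -> forall X : {fset V}, op X).
Variables (beta lambda mu Delta : R).
Hypotheses (metric_dist : is_metric dist) (beta0 : 0 < beta) (lambda0 : 0 < lambda)
  (mu0 : 0 < mu) (Delta0 : 0 < Delta) (beta_small : beta < lambda / (2 * Delta)).
Hypothesis Phit_selfadj : forall L X, selfadj (Phit L X).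
Hypothesis Phit_supp : forall L X, supported_in (fsetIs X L) (Phit L X).
Hypothesis Phit_local : forall L L' X, fsetIs X L' = fsetIs X L -> Phit L X = Phit L' X.
Hypothesis Phit_decay : forall (L : set V) (x : V),
  (\esum_(X in [set X : {fset V} | x \in X])
     (opnorm (Phit L X) * expR (lambda * (#|` X|)%:R + mu * diam dist X))%:E <= Delta%:E)%E.
Variables (Lam A B : {fset V}).
Hypothesis AB0 : (A `&` B = fset0)%fset.

Definition effham (L : set V) : op Lam := \sum_(X <- fpowerset Lam) embed Lam (Phit L X).

Lemma effham_selfadj L : selfadj (effham L).
Proof.
rewrite /effham big_seq; apply/selfadjE; elim/big_ind: _ => [|M N sM sN|X].
- exact: adj0.
- by rewrite adjD sM sN.
- by rewrite fpowersetE => sX; apply/selfadjE; apply: embed_selfadj.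
Qed.

Lemma effham_decay L x :
  \sum_(X <- fpowerset Lam | x \in X) opnorm (Phit L X) * expR (lambda * #|` X|%:R) <= Delta.
Proof.
apply: le_trans (esum_fpowerset_le Lam (Phit_decay L x)); apply: ler_sum => X _.
by rewrite ler_wpM2l ?opnorm_ge0 // ler_expR lerDl mulr_ge0 ?diam_ge0 // ltW.
Qed.

(** The term at [X] of the operator [W], an inclusion-exclusion over the two regions. *)
Definition mixed (X : {fset V}) : op X :=
  Phit [set` (A `|` B)%fset] X - Phit [set` A] X - Phit [set` B] X + Phit set0 X.

(** By locality (ii), when [X] misses [A] the region [A] is invisible to the interaction at [X], and
    the four terms cancel in pairs. *)
Lemma mixed_disjointl X : (X `&` A = fset0)%fset -> mixed X = 0.
Proof.
move=> XA.
have e1 : Phit [set` (A `|` B)%fset] X = Phit [set` B] X.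
  by apply: Phit_local; rewrite !fsetIs_fset fsetIUr XA fset0U.
have e2 : Phit [set` A] X = Phit set0 X.
  by apply: Phit_local; rewrite fsetIs_fset fsetIs_set0 XA.
by rewrite /mixed e1 e2 addrAC subrK subrr.
Qed.

Lemma mixed_disjointr X : (X `&` B = fset0)%fset -> mixed X = 0.
Proof.
move=> XB.
have e1 : Phit [set` (A `|` B)%fset] X = Phit [set` A] X.
  by apply: Phit_local; rewrite !fsetIs_fset fsetIUr XB fsetU0.
have e2 : Phit [set` B] X = Phit set0 X.
  by apply: Phit_local; rewrite fsetIs_fset fsetIs_set0 XB.
by rewrite /mixed e1 e2 subrr add0r addNr.
Qed.

Lemma effham_mixed :
  effham [set` (A `|` B)%fset] - (effham [set` A] + (effham [set` B] - effham set0))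
  = \sum_(X <- fpowerset Lam) embed Lam (mixed X).
Proof.
rewrite /effham !opprD opprK !addrA -!sumrN -!big_split; apply: eq_big_seq => X.
by rewrite fpowersetE => sX /=; rewrite /mixed (embedD sX) !(embedB sX).
Qed.

Lemma opnorm_mixed X : opnorm (mixed X) <=
  opnorm (Phit [set` (A `|` B)%fset] X) + opnorm (Phit [set` A] X)
  + opnorm (Phit [set` B] X) + opnorm (Phit set0 X).
Proof.
apply: (le_trans (opnormD _ _)); rewrite lerD2r.
apply: (le_trans (opnormB _ _)); rewrite lerD2r; exact: opnormB.
Qed.

(** A set containing [x] and a point of [B] has diameter at least the distance from [x] to [B], so
    the weight [e^(mu diam X)] yields the exponential factor. Each of the four interactions
    contributes one [Delta]. *)
Lemma sum_mixed_le x :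
  \sum_(X <- fpowerset Lam | x \in X)
    (if (X `&` B)%fset != fset0 then opnorm (mixed X) * expR (lambda * #|` X|%:R) else 0)
  <= 4 * Delta * expR (- (mu * dist_set dist x B)).
Proof.
set e := expR (- _).
pose G L X := opnorm (Phit L X) * expR (lambda * (#|` X|)%:R + mu * diam dist X).
have G0 L X : 0 <= G L X by rewrite mulr_ge0 ?opnorm_ge0 ?expR_ge0.
apply: (@le_trans _ _ (\sum_(X <- fpowerset Lam | x \in X)
   (G [set` (A `|` B)%fset] X + G [set` A] X + G [set` B] X + G set0 X) * e)).
  apply: ler_sum => X xX; case: ifPn => [/fset0Pn [y]|_]; last first.
    by rewrite mulr_ge0 ?expR_ge0 // !addr_ge0.
  rewrite in_fsetI => /andP[yX yB].
  have he : expR (lambda * #|` X|%:R) <= expR (lambda * #|` X|%:R + mu * diam dist X) * e.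
    rewrite -expRD ler_expR -addrA lerDl subr_ge0 ler_wpM2l ?(ltW mu0) //.
    exact: (dist_set_le_diam metric_dist xX yX yB).
  rewrite /G -!mulrDl -mulrA; apply: ler_pM; rewrite ?opnorm_ge0 ?expR_ge0 //.
  exact: opnorm_mixed.
rewrite -mulr_suml; apply: ler_wpM2r; first exact: expR_ge0.
rewrite !big_split /=.
have GD L : \sum_(X <- fpowerset Lam | x \in X) G L X <= Delta.
  exact: esum_fpowerset_le (Phit_decay L x).
have -> : 4 * Delta = Delta + Delta + Delta + Delta by ring.
by apply: lerD (GD _); apply: lerD (GD _); apply: lerD (GD _) (GD _).
Qed.

Let kappa := lambda / (lambda - 2 * Delta * beta).

Lemma kappa_ge0 : 0 <= kappa.
Proof.
have D2 : 0 < 2 * Delta by rewrite mulr_gt0.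
rewrite divr_ge0 ?(ltW lambda0) // subr_ge0 mulrC -ler_pdivlMr // ltW //.
Qed.

(** Each mixed term costs a factor [kappa] under conjugation. Those missing [A] or [B] vanish, and
    the others are counted from their points in [A]. *)
Lemma opnorm_conj_mixed (s : R) : 0 <= s <= beta ->
  opnorm (expm (((- s)%:C)%C *: effham [set` (A `|` B)%fset])
          *m (\sum_(X <- fpowerset Lam) embed Lam (mixed X))
          *m expm ((s%:C)%C *: effham [set` (A `|` B)%fset]))
  <= 4 * Delta * kappa * \sum_(x <- A) expR (- (mu * dist_set dist x B)).
Proof.
move=> sb; rewrite mulmx_sumr mulmx_suml; apply: (le_trans (opnorm_sum _ _ _)).
pose F X : R := if (X `&` B)%fset != fset0
  then opnorm (mixed X) * expR (lambda * #|` X|%:R) else 0.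
have F0 X : 0 <= F X by rewrite /F; case: ifP => // _; rewrite mulr_ge0 ?opnorm_ge0 ?expR_ge0.
apply: (@le_trans _ _ (kappa * \sum_(X <- fpowerset Lam | (X `&` A)%fset != fset0) F X)).
  rewrite mulr_sumr [leRHS]big_mkcond /= big_seq [leRHS]big_seq; apply: ler_sum => X.
  rewrite fpowersetE => sX.
  case: ifPn => [_|]; last first.
    rewrite negbK => /eqP /mixed_disjointl ->.
    by rewrite (embed0 R D sX) mulmx0 mul0mx opnorm0.
  rewrite /F; case: ifPn => [_|]; last first.
    rewrite negbK => /eqP /mixed_disjointr ->.
    by rewrite (embed0 R D sX) mulmx0 mul0mx opnorm0 mulr0.
  rewrite [leRHS]mulrC.
  exact: (opnorm_conj_local D0 lambda0 Delta0 (effham_decay _) (mixed X)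
           (effham_selfadj _) sb beta_small sX).
have -> : 4 * Delta * kappa * \sum_(x <- A) expR (- (mu * dist_set dist x B))
    = kappa * \sum_(x <- A) 4 * Delta * expR (- (mu * dist_set dist x B)).
  by rewrite -mulr_sumr mulrA [kappa * _]mulrC.
apply: ler_wpM2l; first exact: kappa_ge0.
apply: (le_trans (sum_meeting _ _ F0)); apply: ler_sum => x _; exact: sum_mixed_le.
Qed.

(** The terms are supported in [L] and [L'] respectively. With one of them empty, this says that
    [effham set0] commutes with every effective Hamiltonian. *)
Lemma effham_comm (L L' : set V) : L `&` L' = set0 -> comm_mx (effham L) (effham L').
Proof.
move=> LL'; apply: (@comm_interaction _ _ _ (fun X => fsetIs X L) (fun X => fsetIs X L')) => //.
- by move=> X; apply/fsubsetP => x; rewrite !inE /= => /andP[].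
- by move=> X; apply/fsubsetP => x; rewrite !inE /= => /andP[].
move=> X X'; apply/fsetP => x; rewrite !inE /=; apply/negP => /andP[/andP[_ xL] /andP[_ xL']].
have : (L `&` L') x by split; apply/set_mem.
by rewrite LL'.
Qed.

Lemma opnorm_effham_product (c := 4 * Delta * lambda * beta / (lambda - 2 * Delta * beta))
    (sig := \sum_(x <- A) expR (- (mu * dist_set dist x B))) :
  opnorm (expm (((- beta)%:C)%C *: effham [set` (A `|` B)%fset])
    *m (expm ((beta%:C)%C *: effham [set` A])
        *m (expm ((beta%:C)%C *: effham [set` B]) *m expm (((- beta)%:C)%C *: effham set0)))
    - 1%:M) <= expR (c * sig) * (c * sig).
Proof.
pose T s := expm ((s%:C)%C *: effham [set` A])
  *m (expm ((s%:C)%C *: effham [set` B]) *m expm (((- s)%:C)%C *: effham set0)).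
have sH := effham_selfadj.
have comm_exp L L' s t : L `&` L' = set0 ->
    comm_mx (expm ((s%:C)%C *: effham L)) (expm ((t%:C)%C *: effham L')).
  move=> LL'; apply: (expm_comm t (sH L')); apply: esym.
  by apply: (expm_comm s (sH L)); apply: effham_comm; rewrite setIC.
have cAB : [set` A] `&` [set` B] = set0.
  apply/seteqP; split => // x /= [xA xB].
  have : x \in (A `&` B)%fset by rewrite in_fsetI xA.
  by rewrite AB0.
(* [T] is a one-parameter group because its three factors commute; its generator is
   [K_A + K_B - K_0], so the perturbation in the interaction picture is [W]. *)
have TX s k : T (k%:R * s) = T s ^+ k.
  rewrite /T -mulrN !(expm_natZ _ _ (sH _)).
  apply: esym; apply: expr_mulmx3; first exact: comm_exp.
    by apply: comm_exp; rewrite setI0.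
  by apply: comm_exp; rewrite setI0.
have hT : first_order beta T (effham [set` A] + (effham [set` B] - effham set0)).
  apply: first_orderM; [exact: ltW | exact: first_order_expm |].
  by apply: first_orderM; [exact: ltW | exact: first_order_expm | exact: first_order_expmN].
have sig0 : 0 <= sig by apply: sumr_ge0 => x _; exact: expR_ge0.
have w0 : 0 <= 4 * Delta * kappa * sig.
  apply: mulr_ge0 => //; apply: mulr_ge0; last exact: kappa_ge0.
  by rewrite mulr_ge0 // ltW.
have hw (s : R) : 0 <= s <= beta ->
    opnorm (expm (((- s)%:C)%C *: effham [set` (A `|` B)%fset])
      *m (effham [set` (A `|` B)%fset] - (effham [set` A] + (effham [set` B] - effham set0)))
      *m expm ((s%:C)%C *: effham [set` (A `|` B)%fset])) <= 4 * Delta * kappa * sig.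
  by move=> sb; rewrite effham_mixed; exact: opnorm_conj_mixed.
have := opnorm_interaction_picture (sH _) beta0 w0 TX hT hw.
have -> : beta * (4 * Delta * kappa * sig) = c * sig.
  by rewrite /c /kappa; move: (sig) ((lambda - 2 * Delta * beta)^-1) => u v; ring.
move=> /le_trans; apply; exact: expR_sub1_le.
Qed.

End EffectiveInteraction.
End Interactions.

(** * The product of marginals of the Gibbs state *)

Lemma natrX_neq0 (R : realType) (D k : nat) : (0 < D)%N -> (D%:R : R[i]) ^+ k != 0.
Proof. by move=> D0; rewrite expf_neq0 // pnatr_eq0 -lt0n. Qed.

Theorem theorem4p1 (R : realType) (V : choiceType) (dist : V -> V -> R) (D : nat)
    (Phi : forall X : {fset V}, op R D X)
    (Phit : set V -> forall X : {fset V}, op R D X)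
    (beta lambda mu Delta : R) :
  (0 < D)%N -> is_metric dist ->
  (* Phi is a local interaction *)
  (forall X, selfadj (Phi X)) ->
  0 < beta ->
  (* strong local effective Hamiltonians at beta *)
  (forall L X, selfadj (Phit L X)) ->
  (forall L X, supported_in (fsetIs X L) (Phit L X)) ->
  (forall L L' X, fsetIs X L' = fsetIs X L -> Phit L X = Phit L' X) ->
  (forall (L : set V) (Lam : {fset V}),
     - (beta^-1)%:C%C *: slog (condexp L (expm (- (beta%:C)%C *: hamiltonian Phi Lam)))
     = \sum_(X <- fpowerset Lam) embed Lam (Phit L X)) ->
  (* decay assumption *)
  0 < lambda -> 0 < mu -> 0 < Delta ->
  (forall (L : set V) (x : V),
     (\esum_(X in [set X : {fset V} | x \in X])
        (opnorm (Phit L X) * expR (lambda * (#|` X|)%:R + mu * diam dist X))%:E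
      <= Delta%:E)%E) ->
  beta < lambda / (2 * Delta) ->
  forall (Lam A C : {fset V}),
    (A `<=` Lam)%fset -> (C `<=` Lam)%fset -> (A `&` C = fset0)%fset -> A != fset0 -> C != fset0 ->
    let rho := gibbs Phi beta Lam in
    let K := 4 * Delta * lambda * beta / (lambda - 2 * Delta * beta) in
    let s := \sum_(x <- A) expR (- (mu * dist_set dist x C)) in
    opnorm (ptrace (A `|` C)%fset rho
              *m (embed (A `|` C)%fset (invmx (ptrace A rho))
                  *m embed (A `|` C)%fset (invmx (ptrace C rho)))
            - 1%:M)
    <= expR (K * s) * (K * s).
Proof.
move=> D0 metric_dist Phi_selfadj beta0 Phit_selfadj Phit_supp Phit_local Phit_log
  lambda0 mu0 Delta0 Phit_decay beta_small Lam A C sA sC AC0 _ _.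
cbv zeta; set rho := gibbs Phi beta Lam.
have sU : (A `|` C `<=` Lam)%fset by rewrite fsubUset sA.
pose H := effham Phit Lam.
have sH L : selfadj (H L) by exact: effham_selfadj.
set E := expm (- (beta%:C)%C *: hamiltonian Phi Lam).
have EE : E = expm (((- beta)%:C)%C *: hamiltonian Phi Lam) by rewrite /E rmorphN.
(* The original Hamiltonian is the [effham] of the family that does not depend on [L]. *)
have sHam : selfadj (hamiltonian Phi Lam) :=
  @effham_selfadj R V D (fun=> Phi) (fun=> Phi_selfadj) Lam set0.
have sE : selfadj E by rewrite EE; exact: expm_selfadj.
have pE : posdef E by rewrite EE; exact: expm_posdef.
have marg (B : {fset V}) L : fsetIs Lam L = B ->
    embed Lam (ptrace B E) = ((D%:R : R[i]) ^+ #|` (Lam `\` B)%fset|)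
      *: expm (((- beta)%:C)%C *: H L).
  by move=> LB; apply: (ptrace_effective D0 beta0 sE pE LB); exact: Phit_log.
have margF (B : {fset V}) : (B `<=` Lam)%fset ->
    embed Lam (ptrace B E) = ((D%:R : R[i]) ^+ #|` (Lam `\` B)%fset|)
      *: expm (((- beta)%:C)%C *: H [set` B]).
  by move=> sB; apply: marg; rewrite fsetIs_fset; apply/fsetIidPr.
have d_neq0 k := natrX_neq0 R k D0.
have PP L : expm (((- beta)%:C)%C *: H L) *m expm ((beta%:C)%C *: H L) = 1%:M.
  by have := expm_mulN (- beta) (sH L); rewrite opprK.
set z := \tr E.
(* The empty region turns the marginal into the partition function, which is thus a multiple of
   [e^(-beta K_0)]. *)
have zE : z%:M = ((D%:R : R[i]) ^+ #|` Lam|) *: expm (((- beta)%:C)%C *: H set0).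
  by rewrite -embed_ptrace_fset0 (marg _ _ (fsetIs_set0 _)) fsetD0.
have z0 : z != 0.
  exact: (scalar_mx_neq0 (enum_rank [ffun=> Ordinal D0]) (d_neq0 _) (PP set0) zE).
have rhoE : rho = z^-1 *: E := erefl _.
have ptr (B : {fset V}) : (B `<=` Lam)%fset -> ptrace B rho = z^-1 *: ptrace B E.
  by move=> sB; rewrite rhoE; exact: (ptraceZ sB).
have embF (B : {fset V}) : (B `<=` Lam)%fset ->
    embed Lam (ptrace B rho) = (z^-1 * (D%:R : R[i]) ^+ #|` (Lam `\` B)%fset|)
      *: expm (((- beta)%:C)%C *: H [set` B]).
  by move=> sB; rewrite (ptr _ sB) (embedZ sB) (margF _ sB); exact: scalerA.
have embV (B : {fset V}) : (B `<=` Lam)%fset ->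
    embed Lam (invmx (ptrace B rho)) = (z^-1 * (D%:R : R[i]) ^+ #|` (Lam `\` B)%fset|)^-1
      *: expm ((beta%:C)%C *: H [set` B]).
  move=> sB; apply: (embed_invmx D0 sB _ _ (embF _ sB)).
  - rewrite (ptr _ sB); apply: (scale_unitmx (invr_neq0 z0)).
    exact: (posdef_unitmx (ptrace_posdef D0 sB pE)).
  - exact: (mulf_neq0 (invr_neq0 z0) (d_neq0 _)).
  - exact: PP.
have sAU : (A `<=` A `|` C)%fset by exact: fsubsetUl.
have sCU : (C `<=` A `|` C)%fset by exact: fsubsetUr.
(* The norm is computed in the algebra of [Lam], where all three marginals become exponentials. *)
rewrite -(opnorm_embed D0 sU) (embedB sU) (embed1 _ _ sU) !(embedM D0 sU).
rewrite (embed_embed _ sAU sU) (embed_embed _ sCU sU).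
rewrite (embF _ sU) (embV _ sA) (embV _ sC).
rewrite (scale_cancel _ _ _ z0 (d_neq0 _) (d_neq0 _) (d_neq0 _) _ zE); last first.
  (* The powers of [D] balance because [A] and [C] are disjoint: the complements of the union and of
     the empty set have together as many sites as those of [A] and [C]. *)
  rewrite -!exprD; congr (_ ^+ _).
  have cL (B : {fset V}) : (B `<=` Lam)%fset -> (#|` (Lam `\` B)%fset| + #|` B|)%N = #|` Lam|.
    by move=> sB; rewrite -(cardfsID B Lam) addnC; congr (#|` _| + _)%N; apply/esym/fsetIidPr.
  have cU : #|` (A `|` C)%fset| = (#|` A| + #|` C|)%N.
    by rewrite -cardfsUI AC0 cardfs0 addn0.
  move: (cL _ sA) (cL _ sC) (cL _ sU); rewrite cU; clear; lia.
exact: opnorm_effham_product.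
Qed.
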